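(* Let $P,Q\in\mathcal{G}_n$ with $\|P-Q\|_\infty<1$, and let $X$ be the unique Hermitian matrix with $X=PX+XP$, $\|X\|_\infty<\pi/2$ and $Q=e^{iX}Pe^{-iX}$, so that $\sigma(|X|)\subseteq[0,\pi/2)$. If $\sigma(|X|)$ has more than one element, then the minimal curves joining $P$ with $Q$ in $\mathcal{G}_n$ are precisely the curves of the form $$\delta(t)=\begin{pmatrix}\gamma_X(t)&0\\0&\alpha_1(t)\end{pmatrix},\qquad t\in[0,1],$$ with respect to $\mathbb{C}^n=\mathcal S_X\oplus\mathcal S_X^\perp$, where $\alpha_1:[0,1]\to\mathcal{G}(\mathcal S_X^\perp)$ is any curve joining $P|_{\mathcal S_X^\perp}$ with $Q|_{\mathcal S_X^\perp}$ such that $\|\dot\alpha_1\|_\infty\le\|X\|_\infty$.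
   Context: $\mathcal{G}_n$ is the set of orthogonal projections in $M_n(\mathbb{C})$ (the Grassmannian), and for a subspace $\mathcal S\subseteq\mathbb{C}^n$, $\mathcal{G}(\mathcal S)$ is the set of orthogonal projections acting on $\mathcal S$. $\|\cdot\|_\infty$ is the spectral (operator) norm, $|X|=(X^*X)^{1/2}$, and $\sigma(\cdot)$ is the set of eigenvalues. The tangent space of $\mathcal{G}_n$ at $P$ is $T_P\mathcal{G}_n=\{X\in M_n(\mathbb{C}): X^*=X,\ X=PX+XP\}$, with Finsler metric $\|X\|_P=\|X\|_\infty$. The length of a (piecewise smooth) curve $\delta:[0,1]\to\mathcal{G}_n$ is $L(\delta)=\int_0^1\|\dot\delta(t)\|_\infty dt$; a curve joining $P$ with $Q$ is minimal if its length is the infimum of the lengths of the piecewise smooth curves in $\mathcal{G}_n$ joining $P$ with $Q$. Convention: minimal curves are parametrized by $[0,1]$ so that $t\mapsto\|\dot\delta(t)\|_\infty$ is constant. It is a known fact that if $\|P-Q\|_\infty<1$ there is a unique $X\in T_P\mathcal{G}_n$ with $\|X\|_\infty<\pi/2$ and $Q=e^{iX}Pe^{-iX}$. For this $X$, put $\mathcal S_X=\ker(\|X\|_\infty I-|X|)$, and let $P_X$ be the orthogonal projection onto $\mathcal S_X$; $P_X$ commutes with $P$ and with $X$. The curve $\gamma_X$ is the compression $\gamma_X(t)=P_X\,(e^{itX}Pe^{-itX})\,P_X|_{\mathcal S_X}$, which takes values in $\mathcal{G}(\mathcal S_X)$. *)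

(* Defs.v *)
From HB Require Import structures.
From mathcomp Require Import all_boot all_order all_algebra.
From mathcomp Require Import all_classical all_reals all_analysis.
From mathcomp Require Import complex.

Set Implicit Arguments.
Unset Strict Implicit.
Unset Printing Implicit Defensive.

Import Order.TTheory GRing.Theory Num.Theory.
Import numFieldNormedType.Exports.

Local Open Scope classical_set_scope.
Local Open Scope ring_scope.
Local Open Scope sesquilinear_scope.

(* Vectors of C^n are columns and matrices act on them from the left. *)

Definition vnorm (R : realType) (n : nat) (v : 'cV[R[i]]_n) : R :=
  Num.sqrt (\sum_(j < n) (complex.Re (v j 0) ^+ 2 + complex.Im (v j 0) ^+ 2)).

Definition opnorm (R : realType) (n : nat) (A : 'M[R[i]]_n) : R :=
  sup [set vnorm (A *m v) | v in [set v : 'cV[R[i]]_n | vnorm v <= 1]].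

(* The exponential series, summed entrywise (real and imaginary parts). *)
Definition expmx_partial (R : realType) (n : nat) (A : 'M[R[i]]_n) (N : nat)
    : 'M[R[i]]_n :=
  \sum_(k < N) (k`!%:R)^-1 *: A ^+ k.

Definition expmx (R : realType) (n : nat) (A : 'M[R[i]]_n) : 'M[R[i]]_n :=
  \matrix_(j, k)
    (limn (fun N => complex.Re (expmx_partial A N j k)) +i*
     limn (fun N => complex.Im (expmx_partial A N j k)))%C.

(* |X| is the positive semidefinite square root of X^* X; the square root is
   taken on the eigenvalues of X^* X (see absmx_sqr and absmx_ge0). *)
Definition absmx (R : realType) (n : nat) (X : 'M[R[i]]_n) : 'M[R[i]]_n :=
  let A := X^t* *m X in
  invmx (spectralmx A) *m diag_mx (map_mx sqrtC (spectral_diag A))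
    *m spectralmx A.

Definition orthproj (R : realType) (n : nat) (P : 'M[R[i]]_n) : Prop :=
  P^t* = P /\ P *m P = P.

Definition tangent (R : realType) (n : nat) (P X : 'M[R[i]]_n) : Prop :=
  X^t* = X /\ X = P *m X + X *m P.

(* The curve t |-> e^{itX} P e^{-itX}. *)
Definition flow (R : realType) (n : nat) (P X : 'M[R[i]]_n) (t : R)
    : 'M[R[i]]_n :=
  expmx ((0 +i* t)%C *: X) *m P *m expmx ((0 +i* - t)%C *: X).

(* A curve on [0,1] is represented by a function on R whose values outside
   [0,1] are irrelevant. *)

Definition re_entry (R : realType) (n : nat) (f : R -> 'M[R[i]]_n)
    (j k : 'I_n) : R -> R := fun t => complex.Re (f t j k).

Definition im_entry (R : realType) (n : nat) (f : R -> 'M[R[i]]_n)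
    (j k : 'I_n) : R -> R := fun t => complex.Im (f t j k).

Definition mxderivable (R : realType) (n : nat) (f : R -> 'M[R[i]]_n) (t : R)
    : Prop :=
  forall j k, derivable (re_entry f j k) t 1 /\ derivable (im_entry f j k) t 1.

Definition mxderive (R : realType) (n : nat) (f : R -> 'M[R[i]]_n) (t : R)
    : 'M[R[i]]_n :=
  \matrix_(j, k) (derive1 (re_entry f j k) t +i* derive1 (im_entry f j k) t)%C.

Definition smooth_fun (R : realType) (f : R -> R) : Prop :=
  forall (d : nat) (t : R), derivable (derive1n d f) t 1.

Definition smooth_mx (R : realType) (n : nat) (f : R -> 'M[R[i]]_n) : Prop :=
  forall j k, smooth_fun (re_entry f j k) /\ smooth_fun (im_entry f j k).

(* Being smooth on a closed piece [s_l, s_(l+1)] means agreeing there with a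
   smooth function on R. As the pieces are closed, this entails continuity on
   [0,1]. *)
Definition piecewise_smooth (R : realType) (n : nat) (f : R -> 'M[R[i]]_n)
    : Prop :=
  exists (N : nat) (s : nat -> R),
    [/\ s 0%N = 0, s N = 1, forall l, (l < N)%N -> s l < s l.+1 &
      forall l, (l < N)%N -> exists g : R -> 'M[R[i]]_n,
        smooth_mx g /\ forall t, s l <= t <= s l.+1 -> f t = g t].

Definition grass_curve (R : realType) (n : nat) (P Q : 'M[R[i]]_n)
    (f : R -> 'M[R[i]]_n) : Prop :=
  [/\ piecewise_smooth f, forall t, 0 <= t <= 1 -> orthproj (f t),
      f 0 = P & f 1 = Q].

(* The derivative may fail to exist at the finitely many break points and at
   0 and 1; these do not affect the integral. *)
Definition curve_length (R : realType) (n : nat) (f : R -> 'M[R[i]]_n)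
    : \bar R :=
  (\int[@lebesgue_measure R]_(t in `[0%R, 1%R]) (opnorm (mxderive f t))%:E)%E.

Definition constant_speed (R : realType) (n : nat) (f : R -> 'M[R[i]]_n)
    : Prop :=
  exists c : R, forall t, 0 < t < 1 -> mxderivable f t ->
    opnorm (mxderive f t) = c.

Definition minimal_curve (R : realType) (n : nat) (P Q : 'M[R[i]]_n)
    (f : R -> 'M[R[i]]_n) : Prop :=
  [/\ grass_curve P Q f,
      curve_length f = ereal_inf [set curve_length g | g in grass_curve P Q] &
      constant_speed f].

Definition SX (R : realType) (n : nat) (X : 'M[R[i]]_n) : set 'cV[R[i]]_n :=
  [set v | (((opnorm X)%:C)%C%:M - absmx X) *m v = 0].

Definition orthoset (R : realType) (n : nat) (S : set 'cV[R[i]]_n)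
    : set 'cV[R[i]]_n :=
  [set w | forall v, S v -> v^t* *m w = 0].

(* The columns of V form an orthonormal basis of the subspace S. Through such a
   basis an operator on S is a k x k matrix, orthogonal projections acting on S
   are the orthogonal projections in M_k(C), and operator norms agree. *)
Definition onbasis (R : realType) (n k : nat) (S : set 'cV[R[i]]_n)
    (V : 'M[R[i]]_(n, k)) : Prop :=
  V^t* *m V = 1%:M /\ S = [set V *m c | c in [set: 'cV[R[i]]_k]].

(* The orthogonal projection onto the span of orthonormal columns V. *)
Definition projspan (R : realType) (n k : nat) (V : 'M[R[i]]_(n, k))
    : 'M[R[i]]_n := V *m V^t*.

(* The matrix, in the orthonormal basis V of S, of the restriction A|_S (when A
   leaves S invariant). *)
Definition restrict_to (R : realType) (n k : nat) (V : 'M[R[i]]_(n, k))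
    (A : 'M[R[i]]_n) : 'M[R[i]]_k := V^t* *m A *m V.

(* V is meant to be an orthonormal basis of SX X, so that projspan V is P_X. *)
Definition gammaX (R : realType) (n k : nat) (V : 'M[R[i]]_(n, k))
    (P X : 'M[R[i]]_n) (t : R) : 'M[R[i]]_k :=
  restrict_to V (projspan V *m flow P X t *m projspan V).

(* The operator on C^n whose matrix is block diagonal with blocks A and B in the
   orthonormal basis formed by the columns of V and W. *)
Definition block_diag (R : realType) (n k m : nat) (V : 'M[R[i]]_(n, k))
    (W : 'M[R[i]]_(n, m)) (A : 'M[R[i]]_k) (B : 'M[R[i]]_m) : 'M[R[i]]_n :=
  row_mx V W *m block_mx A 0 0 B *m (row_mx V W)^t*.

Lemma spectral_diag_gram_ge0 (R : realType) (n : nat) (X : 'M[R[i]]_n) j :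
  0 <= spectral_diag (X^t* *m X) 0 j.
Proof.
set A := X^t* *m X.
have Ah : A^t* = A by rewrite /A trmx_mul map_mxM trmxCK.
have nA : A \is normalmx by apply/normalmxP; rewrite Ah.
have := orthomx_spectralP nA; set U := spectralmx A; set d := spectral_diag A.
have uU : U \is unitarymx by exact: spectral_unitarymx.
move=> eA.
have eD : diag_mx d = (X *m U^t*)^t* *m (X *m U^t*).
  rewrite trmx_mul map_mxM trmxCK !mulmxA -(mulmxA U) -/A eA.
  rewrite invmx_unitary // !mulmxA (unitarymxP uU) mul1mx -mulmxA.
  by rewrite (unitarymxP uU) mulmx1.
have /matrixP/(_ j j) := eD.
rewrite !mxE eqxx mulr1n => ->.
by apply: sumr_ge0 => l _; rewrite !mxE mulrC mul_conjC_ge0.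
Qed.

Lemma absmx_sqr (R : realType) (n : nat) (X : 'M[R[i]]_n) :
  absmx X *m absmx X = X^t* *m X.
Proof.
rewrite /absmx; set A := X^t* *m X.
have Ah : A^t* = A by rewrite /A trmx_mul map_mxM trmxCK.
have nA : A \is normalmx by apply/normalmxP; rewrite Ah.
have := orthomx_spectralP nA; set U := spectralmx A; set d := spectral_diag A.
have uU : U \in unitmx by exact: spectral_unit.
move=> ->; rewrite !mulmxA mulmxK //; congr (_ *m _).
rewrite -mulmxA; congr (_ *m _).
rewrite mulmx_diag; congr diag_mx; apply/rowP => j; rewrite !mxE.
by rewrite -expr2 sqrtCK.
Qed.

Lemma absmx_ge0 (R : realType) (n : nat) (X : 'M[R[i]]_n) (v : 'cV[R[i]]_n) :
  0 <= (v^t* *m absmx X *m v) 0 0.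
Proof.
rewrite /absmx; set A := X^t* *m X.
set U := spectralmx A; set d := spectral_diag A.
have uU : U \is unitarymx by exact: spectral_unitarymx.
rewrite invmx_unitary // !mulmxA -(mulmxA _ U v).
have -> : v^t* *m U^t* = (U *m v)^t* by rewrite trmx_mul map_mxM.
rewrite mul_mx_diag mxE; apply: sumr_ge0 => j _; rewrite !mxE.
rewrite mulrAC mulr_ge0 ?sqrtC_ge0 ?spectral_diag_gram_ge0 //.
by rewrite mulrC mul_conjC_ge0.
Qed.

(* Main.v *)
(* For a unit vector v in the range of P, the angle between v and the range of a
   moving projection f(t) grows at rate at most ||f'(t)||, because
   <f'v, v> = 2 Re <f' f v, (1 - f) v>.  If v lies moreover in S_X, then the
   angle between v and the range of Q is ||X||; so every curve from P to Q has
   length at least ||X||, the length of the flow t |-> e^{itX} P e^{-itX}.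

   On a curve of constant speed ||X||, the unit vector u along f(t) v is at angle
   at most t ||X|| from v and, by the same bound on [t, 1], at most (1 - t) ||X||
   from the range of Q.  The spherical triangle inequality is then an equality,
   which determines f(t) v; as the flow is such a curve, f(t) v is the flow
   applied to v.  With 1 - P instead of P, the same holds on S_X and the kernel
   of P.  So f agrees with the flow on S_X and, being Hermitian, it is block
   diagonal.  The converse holds because the speed of a block diagonal curve is
   the maximum of the speeds of its blocks. *)

Require Import Defs.
From HB Require Import structures.
From mathcomp Require Import all_boot all_order all_algebra.
From mathcomp Require Import all_classical all_reals all_analysis.
From mathcomp Require Import measurable_realfun complex ring lra.

Set Implicit Arguments.
Unset Strict Implicit.
Unset Printing Implicit Defensive.

Import Order.TTheory GRing.Theory Num.Theory.
Import numFieldNormedType.Exports.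

Local Open Scope classical_set_scope.
Local Open Scope ring_scope.
Local Open Scope sesquilinear_scope.

(** The obstacle is that the angle phi between [v] and the range of [f t] is not a differentiable
    function of the curve at phi = 0, which is where a curve starts when [v] is in the range of [P].
    What is differentiable is x = cos (2 phi) = 2 <f v, v> - 1, a real affine function of the
    projection, and the rate bound becomes |x'| <= 2 ||f'|| sqrt (1 - x^2). It is integrated after
    multiplying x by a factor r < 1, which keeps the arcsine differentiable; r tends to 1 at the
    end. In the equality case the target is the range of [Q], a subspace and not a point: the unit
    vector w of that range nearest to u depends a priori on f. Equality also forces w = Q v / cos
    ||X||, so f(t) v gets a closed formula in t, v, Q v and ||X|| alone, and the flow obeys the same
    formula. It divides by sin ||X|| and cos ||X||: the first is nonzero because two distinct
    eigenvalues of |X| exclude X = 0, the second because ||X|| < pi / 2. *)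

Local Notation Re := complex.Re.
Local Notation Im := complex.Im.

(** * The real Euclidean structure of C^n *)

Section RealInnerProduct.
Variable R : realType.


Lemma ReD (x y : R[i]) : Re (x + y) = Re x + Re y.
Proof. by case: x; case: y. Qed.

Lemma ImD (x y : R[i]) : Im (x + y) = Im x + Im y.
Proof. by case: x; case: y. Qed.

Lemma ReM (x y : R[i]) : Re (x * y) = Re x * Re y - Im x * Im y.
Proof. by case: x; case: y. Qed.

Lemma ImM (x y : R[i]) : Im (x * y) = Re x * Im y + Im x * Re y.
Proof. by case: x => a b; case: y => c d; rewrite /= [b * c]mulrC. Qed.

Lemma Re_sum (I : Type) (r : seq I) (p : pred I) (F : I -> R[i]) :
  Re (\sum_(j <- r | p j) F j) = \sum_(j <- r | p j) Re (F j).
Proof. by elim/big_ind2: _ => // [a b c d <- <-]; rewrite ReD. Qed.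

Lemma Im_sum (I : Type) (r : seq I) (p : pred I) (F : I -> R[i]) :
  Im (\sum_(j <- r | p j) F j) = \sum_(j <- r | p j) Im (F j).
Proof. by elim/big_ind2: _ => // [a b c d <- <-]; rewrite ImD. Qed.

Lemma Re_conj (x : R[i]) : Re (x^*) = Re x.
Proof. by case: x. Qed.

Lemma Im_conj (x : R[i]) : Im (x^*) = - Im x.
Proof. by case: x. Qed.

Lemma trmxCM (n p q : nat) (A : 'M[R[i]]_(n, p)) (B : 'M[R[i]]_(p, q)) :
  (A *m B)^t* = B^t* *m A^t*.
Proof. by rewrite trmx_mul map_mxM. Qed.

Lemma trmxCB (n p : nat) (A B : 'M[R[i]]_(n, p)) : (A - B)^t* = A^t* - B^t*.
Proof. by rewrite linearB /= map_mxB. Qed.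

Lemma trmxC1 (n : nat) : (1%:M : 'M[R[i]]_n)^t* = 1%:M.
Proof. by rewrite trmx1 map_mx1. Qed.

(* C^n as a real Euclidean space; [vnorm] is the norm of this product. *)
Definition rdot (n : nat) (u v : 'cV[R[i]]_n) : R := Re ((u^t* *m v) 0 0).

Lemma rdotE (n : nat) (u v : 'cV[R[i]]_n) :
  rdot u v = \sum_j (Re (u j 0) * Re (v j 0) + Im (u j 0) * Im (v j 0)).
Proof.
rewrite /rdot !mxE Re_sum; apply: eq_bigr => j _.
by rewrite !mxE ReM Re_conj Im_conj; ring.
Qed.

Lemma rdotC (n : nat) (u v : 'cV[R[i]]_n) : rdot u v = rdot v u.
Proof. by rewrite !rdotE; apply: eq_bigr => j _; ring. Qed.

Lemma rdotDr (n : nat) (u v w : 'cV[R[i]]_n) :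
  rdot u (v + w) = rdot u v + rdot u w.
Proof. by rewrite /rdot mulmxDr mxE ReD. Qed.

Lemma rdotZr (n : nat) (a : R) (u v : 'cV[R[i]]_n) :
  rdot u (a%:C%C *: v) = a * rdot u v.
Proof. by rewrite /rdot -scalemxAr mxE ReM /= mul0r subr0. Qed.

Lemma rdotNr (n : nat) (u v : 'cV[R[i]]_n) : rdot u (- v) = - rdot u v.
Proof. by rewrite -scaleN1r -(rmorphN1 (real_complex R)) rdotZr mulN1r. Qed.

Lemma rdotBr (n : nat) (u v w : 'cV[R[i]]_n) :
  rdot u (v - w) = rdot u v - rdot u w.
Proof. by rewrite rdotDr rdotNr. Qed.

Lemma rdotDl (n : nat) (u v w : 'cV[R[i]]_n) :
  rdot (u + v) w = rdot u w + rdot v w.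
Proof. by rewrite rdotC rdotDr !(rdotC w). Qed.

Lemma rdotZl (n : nat) (a : R) (u v : 'cV[R[i]]_n) :
  rdot (a%:C%C *: u) v = a * rdot u v.
Proof. by rewrite rdotC rdotZr rdotC. Qed.

Lemma rdotNl (n : nat) (u v : 'cV[R[i]]_n) : rdot (- u) v = - rdot u v.
Proof. by rewrite rdotC rdotNr rdotC. Qed.

Lemma rdotBl (n : nat) (u v w : 'cV[R[i]]_n) :
  rdot (u - v) w = rdot u w - rdot v w.
Proof. by rewrite rdotDl rdotNl. Qed.

Lemma rdot0r (n : nat) (u : 'cV[R[i]]_n) : rdot u 0 = 0.
Proof. by rewrite /rdot mulmx0 mxE. Qed.

Lemma rdot_adj (n p : nat) (A : 'M[R[i]]_(n, p)) u v :
  rdot u (A *m v) = rdot (A^t* *m u) v.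
Proof. by rewrite /rdot trmxCM trmxCK mulmxA. Qed.

Lemma rdot_ge0 (n : nat) (u : 'cV[R[i]]_n) : 0 <= rdot u u.
Proof.
by rewrite rdotE; apply: sumr_ge0 => j _; rewrite addr_ge0 // -expr2 sqr_ge0.
Qed.

Lemma vnormE (n : nat) (u : 'cV[R[i]]_n) : vnorm u = Num.sqrt (rdot u u).
Proof. by rewrite /vnorm rdotE. Qed.

Lemma vnorm_sqr (n : nat) (u : 'cV[R[i]]_n) : vnorm u ^+ 2 = rdot u u.
Proof. by rewrite vnormE sqr_sqrtr ?rdot_ge0. Qed.

Lemma vnorm_ge0 (n : nat) (u : 'cV[R[i]]_n) : 0 <= vnorm u.
Proof. by rewrite vnormE sqrtr_ge0. Qed.

Lemma rdot_eq0 (n : nat) (u : 'cV[R[i]]_n) : rdot u u = 0 -> u = 0.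
Proof.
rewrite rdotE => /eqP; rewrite psumr_eq0 => [/allP h|j _]; last first.
  by rewrite addr_ge0 // -expr2 sqr_ge0.
apply/matrixP => j k; rewrite ord1 mxE.
have := h j (mem_index_enum j); rewrite /= paddr_eq0 -?expr2 ?sqr_ge0 //.
by rewrite !sqrf_eq0; case: (u j 0) => a b /= /andP[/eqP-> /eqP->].
Qed.

Lemma vnorm_eq0 (n : nat) (u : 'cV[R[i]]_n) : vnorm u = 0 -> u = 0.
Proof. by move=> u0; apply: rdot_eq0; rewrite -vnorm_sqr u0 expr0n. Qed.

Lemma vnorm0 (n : nat) : vnorm (0 : 'cV[R[i]]_n) = 0.
Proof. by rewrite vnormE rdot0r sqrtr0. Qed.

Lemma vnorm_gt0 (n : nat) (u : 'cV[R[i]]_n) : u != 0 -> 0 < vnorm u.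
Proof.
by move=> u0; rewrite lt0r vnorm_ge0 andbT; apply: contra u0 => /eqP/vnorm_eq0->.
Qed.

Lemma vnormZ (n : nat) (a : R) (u : 'cV[R[i]]_n) :
  vnorm (a%:C%C *: u) = `|a| * vnorm u.
Proof.
by rewrite !vnormE rdotZl rdotZr mulrA -expr2 sqrtrM ?sqr_ge0 // sqrtr_sqr.
Qed.

Lemma CauchySchwarz (n : nat) (u v : 'cV[R[i]]_n) :
  rdot u v <= vnorm u * vnorm v.
Proof.
have [->|v0] := eqVneq v 0; first by rewrite rdot0r vnorm0 mulr0.
have v_gt0 := vnorm_gt0 v0.
have [->|u0] := eqVneq u 0; first by rewrite rdotC rdot0r vnorm0 mul0r.
have u_gt0 := vnorm_gt0 u0.
have := rdot_ge0 ((vnorm v)%:C%C *: u - (vnorm u)%:C%C *: v).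
rewrite rdotBl !rdotBr !rdotZl !rdotZr (rdotC v u) -!vnorm_sqr => h.
have : 0 <= (2 * (vnorm u * vnorm v)) * (vnorm u * vnorm v - rdot u v) by nra.
by rewrite pmulr_rge0 ?subr_ge0 // !mulr_gt0.
Qed.

Lemma CauchySchwarz_norm (n : nat) (u v : 'cV[R[i]]_n) :
  `|rdot u v| <= vnorm u * vnorm v.
Proof.
rewrite ler_norml CauchySchwarz andbT lerNl -rdotNr.
by rewrite (le_trans (CauchySchwarz _ _))// !vnormE rdotNl rdotNr opprK.
Qed.

Lemma vnormD (n : nat) (u v : 'cV[R[i]]_n) : vnorm (u + v) <= vnorm u + vnorm v.
Proof.
rewrite -(@ler_pXn2r _ 2) ?nnegrE ?addr_ge0 ?vnorm_ge0 //.
rewrite vnorm_sqr rdotDl !rdotDr (rdotC v u) sqrrD !vnorm_sqr.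
by have := CauchySchwarz u v; lra.
Qed.

Lemma vec_eqP (n : nat) (u v : 'cV[R[i]]_n) :
  (forall w, rdot w u = rdot w v) -> u = v.
Proof.
move=> h; apply/eqP; rewrite -subr_eq0; apply/eqP/rdot_eq0.
by rewrite rdotBr h subrr.
Qed.

Lemma mx_eqP (n p : nat) (A B : 'M[R[i]]_(n, p)) :
  (forall v : 'cV_p, A *m v = B *m v) -> A = B.
Proof.
move=> h; apply/matrixP => j k.
have /matrixP/(_ j 0) := h (delta_mx k 0).
by rewrite -!colE !mxE.
Qed.

Lemma vnorm_unitary (n p : nat) (A : 'M[R[i]]_(n, p)) (v : 'cV_p) :
  A^t* *m A = 1%:M -> vnorm (A *m v) = vnorm v.
Proof. by move=> h; rewrite !vnormE rdot_adj mulmxA h mul1mx. Qed.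

(* Coefficients of the real linear form [A |-> rdot u (A *m v)] in the real and
   imaginary parts of the entries of [A]. *)
Lemma rdot_entries (n p : nat) (u : 'cV[R[i]]_n) (v : 'cV_p) (A : 'M[R[i]]_(n, p)) :
  rdot u (A *m v) = \sum_j \sum_k
    (Re ((u j 0)^* * v k 0) * Re (A j k) - Im ((u j 0)^* * v k 0) * Im (A j k)).
Proof.
rewrite /rdot mxE Re_sum; apply: eq_bigr => j _.
rewrite !mxE mulr_sumr Re_sum; apply: eq_bigr => k _.
by rewrite mulrCA mulrA -mulrA mulrC ReM.
Qed.

Lemma Re_entry_rdot (n p : nat) (A : 'M[R[i]]_(n, p)) j k :
  Re (A j k) = rdot (delta_mx j 0) (A *m delta_mx k 0).
Proof.
rewrite rdotE (bigD1 j) //= big1 => [|l lj]; last first.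
  by rewrite !mxE (negPf lj) /= !mul0r addr0.
by rewrite -colE !mxE !eqxx /=; ring.
Qed.

Lemma Im_entry_rdot (n p : nat) (A : 'M[R[i]]_(n, p)) j k :
  Im (A j k) = rdot ((0 +i* 1)%C *: delta_mx j 0) (A *m delta_mx k 0).
Proof.
rewrite rdotE (bigD1 j) //= big1 => [|l lj]; last first.
  by rewrite !mxE (negPf lj) /= ?(mulr0, mul0r, addr0, subr0, add0r, oppr0)/=; ring.
by rewrite -colE !mxE !eqxx /=; ring.
Qed.

End RealInnerProduct.

(** * The operator norm *)

Lemma Re_le_vnorm (R : realType) (n : nat) (v : 'cV[R[i]]_n) j :
  `|Re (v j 0)| <= vnorm v.
Proof.
rewrite -sqrtr_sqr /vnorm ler_wsqrtr // (bigD1 j) //= -addrA lerDl.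
by rewrite addr_ge0 ?sqr_ge0 // sumr_ge0 // => l _; rewrite addr_ge0 ?sqr_ge0.
Qed.

Lemma Im_le_vnorm (R : realType) (n : nat) (v : 'cV[R[i]]_n) j :
  `|Im (v j 0)| <= vnorm v.
Proof.
rewrite -sqrtr_sqr /vnorm ler_wsqrtr // (bigD1 j) //= addrAC lerDr.
by rewrite addr_ge0 ?sqr_ge0 // sumr_ge0 // => l _; rewrite addr_ge0 ?sqr_ge0.
Qed.

Definition entry_sum (R : realType) (n : nat) (A : 'M[R[i]]_n) : R :=
  \sum_j \sum_k (`|Re (A j k)| + `|Im (A j k)|).

(** A crude bound, obtained by pairing [A *m v] with itself: each coefficient in [rdot_entries] is a
    sum of two products of coordinates, whence the 2. It makes the supremum in [opnorm] finite and
    [opnorm] continuous in the entries. *)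
Lemma vnorm_entry_sum (R : realType) (n : nat) (A : 'M[R[i]]_n) v :
  vnorm (A *m v) <= 2 * entry_sum A * vnorm v.
Proof.
set w := A *m v; have [->|w0] := eqVneq w 0.
  rewrite vnorm0 !mulr_ge0 ?vnorm_ge0 // sumr_ge0 // => j _.
  by rewrite sumr_ge0 // => k _; rewrite addr_ge0.
rewrite -(ler_pM2l (vnorm_gt0 w0)) -expr2 vnorm_sqr {2}/w rdot_entries.
rewrite (_ : vnorm w * (2 * entry_sum A * vnorm v) = vnorm w * vnorm v * 2 *
  entry_sum A); last by ring.
rewrite mulr_sumr; apply: ler_sum => j _.
rewrite mulr_sumr; apply: ler_sum => k _; rewrite mulrDr.
have M (a b c d e f : R) : `|a| <= e -> `|b| <= e -> `|c| <= f -> `|d| <= f ->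
    `|a * c + b * d| <= e * f * 2.
  move=> ae be cf df; rewrite mulr_natr mulr2n.
  by rewrite (le_trans (ler_normD _ _)) // !normrM lerD // ler_pM.
rewrite lerD //; apply: (le_trans (ler_norm _)); rewrite ?normrN normrM ler_wpM2r//.
  rewrite ReM Re_conj Im_conj mulNr opprK.
  by rewrite M ?Re_le_vnorm ?Im_le_vnorm.
rewrite ImM Re_conj Im_conj; apply: M; rewrite ?normrN ?Re_le_vnorm ?Im_le_vnorm //.
Qed.

Lemma opnorm_has_sup (R : realType) (n : nat) (A : 'M[R[i]]_n) :
  has_sup [set vnorm (A *m v) | v in [set v : 'cV[R[i]]_n | vnorm v <= 1]].
Proof.
split; first by exists 0; exists 0; rewrite /= ?mulmx0 vnorm0.
exists (2 * entry_sum A) => _ [v /= v1 <-].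
have S0 : 0 <= 2 * entry_sum A.
  by rewrite mulr_ge0 // sumr_ge0 // => j _; rewrite sumr_ge0 // => k _;
    rewrite addr_ge0.
by rewrite (le_trans (vnorm_entry_sum _ _)) // ler_piMr.
Qed.

Lemma opnorm_ge0 (R : realType) (n : nat) (A : 'M[R[i]]_n) : 0 <= opnorm A.
Proof.
apply: (sup_upper_bound (opnorm_has_sup A)).
by exists 0; rewrite /= ?mulmx0 vnorm0.
Qed.

Lemma vnorm_opnorm (R : realType) (n : nat) (A : 'M[R[i]]_n) v :
  vnorm (A *m v) <= opnorm A * vnorm v.
Proof.
have [->|v0] := eqVneq v 0; first by rewrite mulmx0 vnorm0 mulr0.
have v_gt0 := vnorm_gt0 v0.
rewrite -ler_pdivrMr // mulrC.
have -> : (vnorm v)^-1 * vnorm (A *m v) =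
    vnorm (A *m (((vnorm v)^-1)%:C%C *: v)).
  by rewrite -scalemxAr vnormZ ger0_norm // invr_ge0 ltW.
apply: (sup_upper_bound (opnorm_has_sup A)); eexists; last reflexivity.
by rewrite /= vnormZ ger0_norm ?invr_ge0 ?(ltW v_gt0) // mulVf ?gt_eqF.
Qed.

Lemma opnorm_le (R : realType) (n : nat) (A : 'M[R[i]]_n) c : 0 <= c ->
  (forall v, vnorm (A *m v) <= c * vnorm v) -> opnorm A <= c.
Proof.
move=> c0 Ac; apply: ge_sup; first by have [] := opnorm_has_sup A.
by move=> _ [v /= v1 <-]; rewrite (le_trans (Ac v)) // ler_piMr.
Qed.

Lemma opnorm_eq (R : realType) (n : nat) (A : 'M[R[i]]_n) c v : 0 <= c ->
  (forall w, vnorm (A *m w) <= c * vnorm w) -> v != 0 ->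
  vnorm (A *m v) = c * vnorm v -> opnorm A = c.
Proof.
move=> c0 Ac v0 Av; apply/eqP; rewrite eq_le opnorm_le //=.
by rewrite -(ler_pM2r (vnorm_gt0 v0)) -Av vnorm_opnorm.
Qed.

Lemma opnorm_dist (R : realType) (n : nat) (A B : 'M[R[i]]_n) :
  `|opnorm A - opnorm B| <= 2 * entry_sum (A - B).
Proof.
have S0 (C : 'M[R[i]]_n) : 0 <= 2 * entry_sum C.
  by rewrite mulr_ge0 // sumr_ge0 // => j _; rewrite sumr_ge0 // => k _;
    rewrite addr_ge0.
have half (C D : 'M[R[i]]_n) : opnorm C <= opnorm D + 2 * entry_sum (C - D).
  apply: opnorm_le => [|v]; first by rewrite addr_ge0 ?opnorm_ge0.
  rewrite -{1}(subrK D C) addrC mulmxDl mulrDl (le_trans (vnormD _ _)) //.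
  by rewrite lerD ?vnorm_opnorm ?vnorm_entry_sum.
have sym : entry_sum (B - A) = entry_sum (A - B).
  apply: eq_bigr => j _; apply: eq_bigr => k _; rewrite -opprB mxE.
  by case: ((A - B) j k) => a b /=; rewrite !normrN.
by rewrite ler_distl lerBlDr -{1}sym !half.
Qed.

(** * Matrix-valued curves *)

Lemma is_derive_sum (R : realType) (I : Type) (r : seq I) (f : I -> R -> R)
    (df : I -> R) (t : R) :
  (forall j, is_derive t 1 (f j) (df j)) ->
  is_derive t 1 (fun s => \sum_(j <- r) f j s) (\sum_(j <- r) df j).
Proof.
move=> h; elim: r => [|j r IH].
  rewrite big_nil (_ : (fun _ => _) = cst 0); first exact: is_derive_cst.
  by apply/funext => s; rewrite big_nil.
rewrite big_cons (_ : (fun _ => _) = f j \+ fun s => \sum_(j <- r) f j s).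
  exact: is_deriveD.
by apply/funext => s; rewrite big_cons.
Qed.

Lemma is_derive_re_entry (R : realType) (n : nat) (f : R -> 'M[R[i]]_n) t j k :
  mxderivable f t ->
  is_derive t 1 (fun s => Re (f s j k)) (Re (mxderive f t j k)).
Proof. by move=> /(_ j k)[h _]; rewrite mxE /= derive1E; apply: DeriveDef. Qed.

Lemma is_derive_im_entry (R : realType) (n : nat) (f : R -> 'M[R[i]]_n) t j k :
  mxderivable f t ->
  is_derive t 1 (fun s => Im (f s j k)) (Im (mxderive f t j k)).
Proof. by move=> /(_ j k)[_ h]; rewrite mxE /= derive1E; apply: DeriveDef. Qed.

Lemma is_derive_lin2 (R : realType) (f g : R -> R) (a b df dg t : R) :
  is_derive t 1 f df -> is_derive t 1 g dg ->
  is_derive t 1 (fun s => a * f s + b * g s) (a * df + b * dg).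
Proof.
move=> hf hg.
exact: (@is_deriveD _ _ _ (fun s => a * f s) (fun s => b * g s)).
Qed.

Lemma mxderive_rdot (R : realType) (n : nat) (f : R -> 'M[R[i]]_n) (t : R)
    (u v : 'cV[R[i]]_n) :
  mxderivable f t ->
  is_derive t 1 (fun s => rdot u (f s *m v)) (rdot u (mxderive f t *m v)).
Proof.
move=> ft; rewrite rdot_entries.
rewrite (_ : (fun _ => _) = fun s => \sum_j \sum_k
    (Re ((u j 0)^* * v k 0) * Re (f s j k) - Im ((u j 0)^* * v k 0) * Im (f s j k))).
  apply: is_derive_sum => j; apply: is_derive_sum => k.
  rewrite -mulNr; under eq_fun do rewrite -mulNr.
  by apply: is_derive_lin2; [exact: is_derive_re_entry|exact: is_derive_im_entry].
by apply/funext => s; rewrite rdot_entries.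
Qed.

(** The entries of [f] are themselves such forms, with [u] a basis vector or [i] times one, so the
    forms determine the matrix derivative. Derivatives can then be computed on scalar functions,
    where multiplying [f] by fixed matrices only changes [u] and [v]. *)
Lemma mxderive_unique (R : realType) (n : nat) (f : R -> 'M[R[i]]_n)
    (t : R) (D : 'M[R[i]]_n) :
  (forall u v, is_derive t 1 (fun s => rdot u (f s *m v)) (rdot u (D *m v))) ->
  mxderivable f t /\ mxderive f t = D.
Proof.
move=> h.
have hR j k : is_derive t 1 (re_entry f j k) (Re (D j k)).
  rewrite Re_entry_rdot (_ : re_entry f j k = fun s => rdot (delta_mx j 0) (f s
    *m delta_mx k 0))//.
  by apply/funext => s; rewrite -Re_entry_rdot.
have hI j k : is_derive t 1 (im_entry f j k) (Im (D j k)).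
  rewrite Im_entry_rdot (_ : im_entry f j k = fun s => rdot ((0 +i* 1)%C *:
    delta_mx j 0) (f s *m delta_mx k 0))//.
  by apply/funext => s; rewrite -Im_entry_rdot.
split=> [j k|]; first by split; apply: ex_derive.
apply/matrixP => j k; rewrite mxE !derive1E.
by rewrite (@derive_val _ _ _ _ _ _ _ (hR j k)) (@derive_val _ _ _ _ _ _ _ (hI
  j k)); case: (D j k).
Qed.

Lemma near_mxderive (R : realType) (n : nat) (f g : R -> 'M[R[i]]_n) t :
  (\near t, f t = g t) -> mxderivable f t ->
  mxderivable g t /\ mxderive g t = mxderive f t.
Proof.
move=> fg ft; apply: mxderive_unique => u v.
apply: near_eq_is_derive (mxderive_rdot u v ft).
by near=> s; congr (rdot u (_ *m v)); near: s.
Unshelve. all: by end_near. Qed.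

(* [B *m f *m B^t* + C *m g *m C^t*] covers both block diagonal curves and their
   diagonal blocks. *)
Lemma mxderive_congr2 (R : realType) (n k m : nat) (f : R -> 'M[R[i]]_k)
    (g : R -> 'M[R[i]]_m) (B : 'M[R[i]]_(n, k)) (C : 'M[R[i]]_(n, m)) t :
  mxderivable f t -> mxderivable g t ->
  let h s := B *m f s *m B^t* + C *m g s *m C^t* in
  mxderivable h t /\
  mxderive h t = B *m mxderive f t *m B^t* + C *m mxderive g t *m C^t*.
Proof.
move=> ft gt h; apply: mxderive_unique => u v.
rewrite mulmxDl -!mulmxA rdotDr !(rdot_adj B) !(rdot_adj C).
rewrite (_ : (fun _ => _) = (fun s => rdot (B^t* *m u) (f s *m (B^t* *m v))) \+
   (fun s => rdot (C^t* *m u) (g s *m (C^t* *m v)))).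
  by apply: is_deriveD; exact: mxderive_rdot.
by apply/funext => s; rewrite /h mulmxDl rdotDr -!mulmxA (rdot_adj B) (rdot_adj C).
Qed.

Lemma mxderive_congr (R : realType) (n k : nat) (f : R -> 'M[R[i]]_k)
    (B : 'M[R[i]]_(n, k)) t : mxderivable f t ->
  mxderivable (fun s => B *m f s *m B^t*) t /\
  mxderive (fun s => B *m f s *m B^t*) t = B *m mxderive f t *m B^t*.
Proof.
move=> ft; have [] := @mxderive_congr2 R n k k f f B 0 t ft ft.
rewrite mul0mx mul0mx addr0.
by under eq_fun do rewrite mul0mx mul0mx addr0.
Qed.

(** Coinduction for smoothness: exhibiting a class stable under [derive1] that contains [f] avoids
    computing its higher derivatives. *)
Lemma smooth_closed (R : realType) (T : set (R -> R)) :
  (forall f, T f -> (forall t, derivable f t 1) /\ T (derive1 f)) ->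
  forall f, T f -> smooth_fun f.
Proof.
move=> hT f Tf d; elim: d f Tf => [|d IH] f Tf t; first by have [/(_ t)] := hT f Tf.
by rewrite derive1Sn; apply: IH; have [] := hT f Tf.
Qed.

Lemma smooth_derivable (R : realType) (f : R -> R) (t : R) :
  smooth_fun f -> derivable f t 1.
Proof. by move=> /(_ 0%N). Qed.

Lemma smooth_derive (R : realType) (f : R -> R) :
  smooth_fun f -> smooth_fun (derive1 f).
Proof. by move=> sf d t; rewrite -derive1Sn; exact: sf. Qed.

Lemma smooth_is_derive (R : realType) (f : R -> R) (t : R) :
  smooth_fun f -> is_derive t 1 f ((derive1 f) t).
Proof. by move=> sf; rewrite derive1E; apply: DeriveDef => //; exact:
  smooth_derivable. Qed.

Lemma smooth_lin2 (R : realType) (f g : R -> R) (a b : R) :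
  smooth_fun f -> smooth_fun g -> smooth_fun (fun s => a * f s + b * g s).
Proof.
move=> sf sg.
apply: (@smooth_closed R [set h | exists f g,
  [/\ smooth_fun f, smooth_fun g & h = fun s => a * f s + b * g s]]); last by
    exists f, g.
move=> _ [{sf sg f g}f [g [sf sg ->]]].
have h t := is_derive_lin2 a b (smooth_is_derive t sf) (smooth_is_derive t sg).
split=> [t|]; first exact: ex_derive.
exists (derive1 f), (derive1 g); split; [exact: smooth_derive|exact: smooth_derive|].
by apply/funext => t; rewrite derive1E (@derive_val _ _ _ _ _ _ _ (h t)).
Qed.

Lemma smooth_cst (R : realType) (a : R) : smooth_fun (fun _ : R => a).
Proof.
apply: (@smooth_closed R [set f | exists a, f = cst a]); last by exists a.
move=> _ [b ->]; split=> [t|]; first exact: derivable_cst.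
by exists 0; apply/funext => t; rewrite derive1_cst.
Qed.

Lemma smooth_sum (R : realType) (I : Type) (r : seq I) (f : I -> R -> R) :
  (forall j, smooth_fun (f j)) -> smooth_fun (fun s => \sum_(j <- r) f j s).
Proof.
move=> sf; elim: r => [|j r IH].
  by under eq_fun do rewrite big_nil; exact: smooth_cst.
under eq_fun do rewrite big_cons -[f j _]mul1r -[X in _ + X]mul1r.
exact: smooth_lin2.
Qed.

(** The derivative keeps the shape, with new coefficients, so these functions form a stable class
    for [smooth_closed]. In an eigenbasis of [X] the entries of the flow have this shape. *)
Lemma is_derive_cos_sin (R : realType) (w a b t : R) :
  is_derive t 1 (fun s => a * cos (w * s) + b * sin (w * s))
   ((b * w) * cos (w * t) + (- (a * w)) * sin (w * t)).
Proof.
have hw : is_derive t 1 (fun s => w * s) w.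
  by rewrite -[w in is_derive _ _ _ w]mulr1; exact: (@is_deriveZ _ _ _ id w).
rewrite (_ : _ + _ = a * (- sin (w * t) * w) + b * (cos (w * t) * w)); last by ring.
exact: is_derive_lin2.
Qed.

Lemma smooth_cos_sin (R : realType) (w a b : R) :
  smooth_fun (fun s => a * cos (w * s) + b * sin (w * s)).
Proof.
apply: (@smooth_closed R [set f | exists a b,
  f = fun s => a * cos (w * s) + b * sin (w * s)]); last by exists a, b.
move=> _ [{}a [{}b ->]]; have h t := is_derive_cos_sin w a b t.
split=> [t|]; first exact: ex_derive.
exists (b * w), (- (a * w)).
by apply/funext => t; rewrite derive1E (@derive_val _ _ _ _ _ _ _ (h t)).
Qed.

Lemma smooth_mx_rdot (R : realType) (n : nat) (f : R -> 'M[R[i]]_n) :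
  smooth_mx f <-> forall u v, smooth_fun (fun s => rdot u (f s *m v)).
Proof.
split=> [sf u v|sf j k].
  under eq_fun do rewrite rdot_entries.
  apply: smooth_sum => j; apply: smooth_sum => k.
  by under eq_fun do rewrite -mulNr; have [] := sf j k; exact: smooth_lin2.
split.
- by rewrite /re_entry; under eq_fun do rewrite Re_entry_rdot; exact: sf.
- by rewrite /im_entry; under eq_fun do rewrite Im_entry_rdot; exact: sf.
Qed.

Lemma smooth_mxderivable (R : realType) (n : nat) (f : R -> 'M[R[i]]_n) t :
  smooth_mx f -> mxderivable f t.
Proof. by move=> sf j k; have [h1 h2] := sf j k; split; exact: smooth_derivable. Qed.

Lemma smooth_mx_congr2 (R : realType) (n k m : nat) (f : R -> 'M[R[i]]_k)
    (g : R -> 'M[R[i]]_m) (B : 'M[R[i]]_(n, k)) (C : 'M[R[i]]_(n, m)) :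
  smooth_mx f -> smooth_mx g ->
  smooth_mx (fun s => B *m f s *m B^t* + C *m g s *m C^t*).
Proof.
move=> /smooth_mx_rdot sf /smooth_mx_rdot sg; apply/smooth_mx_rdot => u v.
under eq_fun do rewrite mulmxDl rdotDr -!mulmxA (rdot_adj B) (rdot_adj C)
  -[X in X + _]mul1r -[X in _ + X]mul1r.
exact: smooth_lin2.
Qed.

Lemma smooth_mx_congr (R : realType) (n k : nat) (f : R -> 'M[R[i]]_k)
    (B : 'M[R[i]]_(n, k)) :
  smooth_mx f -> smooth_mx (fun s => B *m f s *m B^t*).
Proof.
move=> sf; have := @smooth_mx_congr2 R n k k f f B 0 sf sf.
by under eq_fun do rewrite mul0mx mul0mx addr0.
Qed.

(** * The exponential of i t X *)

Definition cis (R : realType) (x : R) : R[i] := (cos x +i* sin x)%C.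

Lemma cisD (R : realType) (x y : R) : cis (x + y) = cis x * cis y.
Proof.
by rewrite /cis cosD sinD; simpc; congr (_ +i* _)%C; rewrite addrC [cos x * _]mulrC.
Qed.

Lemma cis0 (R : realType) : cis (0 : R) = 1.
Proof. by rewrite /cis cos0 sin0. Qed.

(** The parity factors are those of [cos_coeff] and [sin_coeff], so that the exponential series
    splits term by term into the cosine and sine series. *)
Lemma imaginary_expr (R : realType) (x : R) n :
  ((0 +i* x)%C ^+ n : R[i]) =
  ((~~ odd n)%:R * (-1) ^+ n./2 * x ^+ n +i* ((odd n)%:R * (-1) ^+ n.-1./2 * x
    ^+ n))%C.
Proof.
rewrite -[in LHS](odd_double_half n) exprD -muln2 mulnC exprM.
have -> : ((0 +i* x)%C ^+ 2 : R[i]) = ((- x ^+ 2)%:C)%C.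
  by rewrite expr2; simpc; congr (_ +i* _)%C; rewrite expr2; ring.
rewrite -rmorphXn /= [in LHS]exprNn -exprM.
rewrite -[in RHS](odd_double_half n) oddD odd_double addbF.
set h := n./2; case: (odd n) => /=.
  rewrite add1n /= doubleK expr1 mul2n; simpc.
  by congr (_ +i* _)%C; rewrite ?exprS; ring.
by rewrite add0n expr0 mul1r doubleK mul2n; simpc.
Qed.

Definition exp_sum (R : realType) (z : R[i]) (N : nat) : R[i] :=
  \sum_(k < N) (k`!%:R)^-1 * z ^+ k.

Lemma natrV_complex (R : realType) n : ((n%:R)^-1 : R[i]) = ((n%:R^-1)%:C)%C.
Proof. by rewrite fmorphV /= rmorph_nat. Qed.

Lemma Re_exp_sum (R : realType) (x : R) N :
  Re (exp_sum (0 +i* x)%C N) = series (cos_coeff x) N.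
Proof.
rewrite /exp_sum Re_sum /series /= big_mkord; apply: eq_bigr => k _.
by rewrite natrV_complex ReM /= mul0r subr0 imaginary_expr mulrC.
Qed.

Lemma Im_exp_sum (R : realType) (x : R) N :
  Im (exp_sum (0 +i* x)%C N) = series (sin_coeff x) N.
Proof.
rewrite /exp_sum Im_sum /series /= big_mkord; apply: eq_bigr => k _.
by rewrite natrV_complex ImM /= mul0r addr0 imaginary_expr mulrC.
Qed.

(** The real and the imaginary part of a fixed complex multiple of the exponential series are both
    combinations of this form. *)
Lemma cvg_exp_sum_lin (R : realType) (a b x : R) :
  (fun N => a * Re (exp_sum (0 +i* x)%C N) + b * Im (exp_sum (0 +i* x)%C N)) @ \oo
    --> a * Re (cis x) + b * Im (cis x).
Proof.
under eq_fun do rewrite Re_exp_sum Im_exp_sum.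
apply: cvgD; apply: cvgMl_tmp; rewrite /= unlock.
- exact: is_cvg_series_cos_coeff.
- exact: is_cvg_series_sin_coeff.
Qed.

Section Spectral.
Context (R : realType) (n : nat) (U : 'M[R[i]]_n) (d : 'rV[R]_n).
Hypothesis UU : U^t* *m U = 1%:M.

Let UU' : U *m U^t* = 1%:M. Proof. exact: mulmx1C. Qed.

Definition expdiag (t : R) : 'M[R[i]]_n := diag_mx (\row_j cis (t * d 0 j)).

Let X := U^t* *m diag_mx (map_mx (real_complex R) d) *m U.

Lemma expdiagD s t : expdiag s *m expdiag t = expdiag (s + t).
Proof.
by rewrite mulmx_diag; congr diag_mx; apply/rowP => j; rewrite !mxE mulrDl cisD.
Qed.

Lemma expdiag0 : expdiag 0 = 1%:M.
Proof.
rewrite -diag_const_mx; congr diag_mx; apply/rowP => j.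
by rewrite !mxE mul0r cis0.
Qed.

Lemma spectral_expr (c : R[i]) k : (c *: X) ^+ k =
  U^t* *m diag_mx (\row_j (c * (d 0 j)%:C%C) ^+ k) *m U.
Proof.
elim: k => [|k IH].
  rewrite (_ : \row_j _ = const_mx 1); last by apply/rowP => j; rewrite !mxE.
  by rewrite diag_const_mx mulmx1 UU.
rewrite exprS IH -mulmxE -scalemxAl /X !mulmxA.
rewrite -[_ *m U *m U^t*]mulmxA UU' mulmx1 -[_ *m _ *m diag_mx (\row_j
  _)]mulmxA mulmx_diag.
rewrite scalemxAl scalemxAr; congr (_ *m _ *m _); apply/matrixP => i j.
by rewrite !mxE exprS mulrnAr mulrA.
Qed.

Lemma spectral_expmx_partial (c : R[i]) N : expmx_partial (c *: X) N =
  U^t* *m diag_mx (\row_j exp_sum (c * (d 0 j)%:C%C) N) *m U.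
Proof.
rewrite /expmx_partial; under eq_bigr do rewrite spectral_expr scalemxAl scalemxAr.
rewrite -mulmx_suml -mulmx_sumr; congr (_ *m _ *m _); apply/matrixP => i j.
rewrite summxE !mxE /exp_sum -sumrMnl; apply: eq_bigr => k _.
by rewrite !mxE mulrnAr.
Qed.

(** [expmx] is an entrywise limit. In an eigenbasis each entry of the partial sums is a finite
    combination of scalar exponential sums, whose limits are taken one by one. *)
Lemma spectral_expmx (t : R) :
  expmx ((0 +i* t)%C *: X) = U^t* *m expdiag t *m U.
Proof.
have entry (r : 'rV[R[i]]_n) i j : (U^t* *m diag_mx r *m U) i j =
    \sum_l (U^t* i l * U l j) * r 0 l.
  rewrite mul_mx_diag mxE; apply: eq_bigr => l _; rewrite !mxE.
  by rewrite mulrAC.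
apply/matrixP => i j; rewrite mxE entry.
under eq_fun do rewrite spectral_expmx_partial entry Re_sum.
under [X in (_ +i* limn X)%C]eq_fun do rewrite spectral_expmx_partial entry Im_sum.
rewrite [RHS](_ : _ = ((\sum_l Re ((U^t* i l * U l j) * (\row_l cis (t * d 0
  l)) 0 l))
   +i* \sum_l Im ((U^t* i l * U l j) * (\row_l cis (t * d 0 l)) 0 l))%C); last first.
  by rewrite -Re_sum -Im_sum; case: (\sum_l _).
have E l : (0 +i* t)%C * (d 0 l)%:C%C = (0 +i* (t * d 0 l))%C by simpc.
congr (_ +i* _)%C; apply: cvg_lim => //; apply: cvg_big => [|l _].
- exact: add_continuous.
- rewrite mxE ReM -mulNr; under eq_fun do rewrite mxE E ReM -mulNr.
  exact: cvg_exp_sum_lin.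
- exact: add_continuous.
- rewrite mxE ImM addrC.
  under eq_fun do rewrite mxE E ImM addrC.
  exact: cvg_exp_sum_lin.
Qed.

End Spectral.

(** The spectral theorem for normal matrices gives a complex diagonal; it equals [U *m X *m U^t*],
    which is Hermitian, so its entries are real. *)
Lemma hermitian_spectral (R : realType) (n : nat) (X : 'M[R[i]]_n) :
  X^t* = X -> exists (U : 'M[R[i]]_n) (d : 'rV[R]_n),
    U^t* *m U = 1%:M /\ X = U^t* *m diag_mx (map_mx (real_complex R) d) *m U.
Proof.
move=> hX; have nX : X \is normalmx by apply/normalmxP; rewrite hX.
have uU := spectral_unitarymx X; have UU := unitarymxP uU.
have eX := orthomx_spectralP nX; rewrite invmx_unitary // in eX.
move: (spectralmx X) (spectral_diag X) UU eX => U d UU eX.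
exists U, (map_mx (@complex.Re R) d); split; first exact: mulmx1C.
rewrite [LHS]eX.
rewrite {1}(_ : d = map_mx (real_complex R) (map_mx (@complex.Re R) d)); first
  reflexivity.
have : (diag_mx d)^t* = diag_mx d.
  have -> : diag_mx d = U *m X *m U^t*.
    by rewrite eX !mulmxA UU mul1mx -mulmxA UU mulmx1.
  by rewrite !trmxCM trmxCK hX mulmxA.
move=> /matrixP h; apply/rowP => j; have := h j j.
rewrite !mxE eqxx !mulr1n; case: (d 0 j) => a b /= [] hb.
by rewrite (_ : b = 0) //; lra.
Qed.

Lemma cisN (R : realType) (x : R) : cis (- x) = (cis x)^*.
Proof. by rewrite /cis cosN sinN. Qed.

Lemma conj_mulmx (R : realType) (n : nat) (U A B : 'M[R[i]]_n) :
  U *m U^t* = 1%:M ->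
  (U^t* *m A *m U) *m (U^t* *m B *m U) = U^t* *m (A *m B) *m U.
Proof.
move=> UV; rewrite (mulmxA _ (U^t* *m B) U) (mulmxA _ (U^t*) B).
by rewrite -(mulmxA _ U (U^t*)) UV mulmx1 (mulmxA (U^t*) A B).
Qed.

Lemma conj_orthproj (R : realType) (n : nat) (A B P : 'M[R[i]]_n) :
  A^t* = B -> B *m A = 1%:M -> orthproj P -> orthproj (A *m P *m B).
Proof.
move=> <- BA [P1 P2]; split; first by rewrite !trmxCM P1 trmxCK mulmxA.
rewrite mulmxA -(mulmxA _ (A^t*)) (mulmxA (A^t*) A) BA mul1mx.
by rewrite -(mulmxA _ P P) P2.
Qed.

Section Exponential.
Context (R : realType) (n : nat) (X : 'M[R[i]]_n).
Hypothesis hX : X^t* = X.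

Local Notation E t := (expmx ((0 +i* t)%C *: X)).

Lemma expmx_spectral : exists (U : 'M[R[i]]_n) (d : 'rV[R]_n),
  [/\ U^t* *m U = 1%:M, U *m U^t* = 1%:M,
      X = U^t* *m diag_mx (map_mx (real_complex R) d) *m U &
      forall t, E t = U^t* *m expdiag d t *m U].
Proof.
have [U [d [UU eX]]] := hermitian_spectral hX.
exists U, d; split; [exact: UU|exact: mulmx1C UU|exact: eX|move=> t].
rewrite eX; exact: (spectral_expmx d UU).
Qed.

Lemma expmxD s t : E s *m E t = E (s + t).
Proof.
have [U [d [UU UV eX eE]]] := expmx_spectral.
rewrite (eE s) (eE t) (eE (s + t)) (conj_mulmx _ _ UV) expdiagD; reflexivity.
Qed.

Lemma expmx0 : E 0 = 1%:M.
Proof.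
have [U [d [UU UV eX eE]]] := expmx_spectral.
by rewrite (eE 0) expdiag0 mulmx1.
Qed.

Lemma expmx_adj t : (E t)^t* = E (- t).
Proof.
have [U [d [UU UV eX eE]]] := expmx_spectral.
rewrite (eE t) (eE (- t)) trmxCM (trmxCM (U^t*) _) trmxCK mulmxA.
rewrite (_ : (expdiag d t)^t* = expdiag d (- t)); first reflexivity.
by apply/matrixP => j k; rewrite !mxE rmorphMn /= mulNr cisN eq_sym; case: eqP
  => // ->.
Qed.

Lemma expmx_comm t : E t *m X = X *m E t.
Proof.
have [U [d [UU UV eX eE]]] := expmx_spectral.
rewrite (eE t) eX (conj_mulmx _ _ UV) (conj_mulmx _ _ UV) /expdiag diag_mxC.
reflexivity.
Qed.

(** This is Euler's formula: on the eigenspace of X^2 for c^2, the operator X / c squares to the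
    identity. *)
Lemma expmx_eigen t c (v : 'cV_n) : c != 0 -> X *m (X *m v) = ((c ^+ 2)%:C)%C *: v ->
  E t *m v = ((cos (t * c))%:C)%C *: v + (0 +i* (sin (t * c) / c))%C *: (X *m v).
Proof.
have [U [d [UU UV eX eE]]] := expmx_spectral.
move=> c0 hv; rewrite (eE t); set D := diag_mx (map_mx (real_complex R) d) in eX.
have {eX}XU w : X *m (U^t* *m w) = U^t* *m (D *m w).
  by rewrite eX -(mulmxA _ U) (mulmxA U) UV mul1mx mulmxA.
have vU : v = U^t* *m (U *m v) by rewrite mulmxA UU mul1mx.
move: (U *m v) vU => w vU; subst v.
rewrite -(mulmxA _ U) (mulmxA U) UV mul1mx -mulmxA XU.
move: hv; rewrite !XU => /(congr1 (mulmx U)).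
rewrite -scalemxAr !(mulmxA U) UV !mul1mx => hw.
rewrite (scalemxAr _ (U^t*) w) (scalemxAr _ (U^t*) (D *m w)) -mulmxDr.
rewrite (_ : expdiag d t *m w =
  (cos (t * c))%:C%C *: w + (0 +i* (sin (t * c) / c))%C *: (D *m w)); first
    reflexivity.
apply/matrixP => j k.
have /matrixP/(_ j k) := hw.
rewrite !mul_diag_mx !mxE mulrA -rmorphM /= => hj.
(* In an eigenbasis, a nonzero coordinate forces [d 0 j] to be [c] or [- c]; as cosine is even and
   sine is odd, both signs obey the same formula. *)
have [->|w0] := eqVneq (w j k) 0; first by rewrite !mulr0 addr0.
have := mulIf w0 hj; case=> /eqP; rewrite -expr2 eqf_sqr.
rewrite mulrA -mulrDl => /orP[]/eqP->; congr (_ * _); rewrite /cis.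
- by simpc; rewrite divfK.
- rewrite mulrN cosN sinN; apply/eqP; rewrite eq_complex /=.
  by apply/andP; split; apply/eqP; field.
Qed.

Lemma expmxNK t : E (- t) *m E t = 1%:M.
Proof. rewrite expmxD addNr; exact: expmx0. Qed.

Lemma flow_orthproj P t : orthproj P -> orthproj (flow P X t).
Proof. exact: conj_orthproj (expmx_adj t) (expmxNK t). Qed.

Lemma flow0 P : flow P X 0 = P.
Proof. by rewrite /flow oppr0 expmx0 mul1mx mulmx1. Qed.

Lemma flow_compl P t : flow (1%:M - P) X t = 1%:M - flow P X t.
Proof.
have := expmxNK (- t); rewrite opprK /flow.
move: (E t) (E (- t)) => A B AB.
by rewrite mulmxBr mulmxBl mulmx1 AB.
Qed.

Lemma flow_smooth P : smooth_mx (flow P X) /\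
  forall t, mxderive (flow P X) t =
    (0 +i* 1)%C *: (X *m flow P X t - flow P X t *m X).
Proof.
have [U [d [UU UV eX eE]]] := expmx_spectral.
have [B eB] : exists B, B = U *m P *m U^t* by eexists.
have [M eM] : exists M : R -> 'M[R[i]]_n,
    forall s, M s = expdiag d s *m B *m expdiag d (- s) by eexists.
(* In an eigenbasis of [X], conjugation by the exponential multiplies the entry (j, k) by e^{i (d_j
   - d_k) s}; smoothness and the derivative are read off these trigonometric functions. *)
have ME s j k : M s j k = B j k * cis ((d 0 j - d 0 k) * s).
  rewrite eM mul_mx_diag mxE mul_diag_mx !mxE [cis _ * B j k]mulrC -mulrA -cisD.
  congr (_ * cis _).
  by ring.
have eF s : flow P X s = U^t* *m M s *m (U^t*)^t*.
  rewrite /flow (eE s) (eE (- s)) trmxCK eM eB.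
  by move: (expdiag _ _) (expdiag _ _) => C D; rewrite !mulmxA.
have eR j k s : Re (M s j k) = Re (B j k) * cos ((d 0 j - d 0 k) * s)
    + (- Im (B j k)) * sin ((d 0 j - d 0 k) * s) by rewrite ME ReM /= mulNr.
have eI j k s : Im (M s j k) = Im (B j k) * cos ((d 0 j - d 0 k) * s)
    + Re (B j k) * sin ((d 0 j - d 0 k) * s) by rewrite ME ImM /= addrC.
have sM : smooth_mx M.
  move=> j k; rewrite /re_entry /im_entry.
  under eq_fun do rewrite eR; under [in X in _ /\ X]eq_fun do rewrite eI.
  by split; exact: smooth_cos_sin.
have -> : flow P X = fun s => U^t* *m M s *m (U^t*)^t* by apply/funext.
split=> [|t]; first exact: smooth_mx_congr.
have [_ ->] := mxderive_congr (U^t*) (smooth_mxderivable t sM).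
have -> : mxderive M t = (0 +i* 1)%C *: (diag_mx (map_mx (real_complex R) d) *m M t
    - M t *m diag_mx (map_mx (real_complex R) d)).
  apply/matrixP => j k; rewrite mxE /re_entry /im_entry.
  under eq_fun do rewrite eR; under [in X in (_ +i* X)%C]eq_fun do rewrite eI.
  rewrite !derive1E !(@derive_val _ _ _ _ _ _ _ (is_derive_cos_sin _ _ _ _)).
  rewrite mul_diag_mx mul_mx_diag !mxE [_ * M t j k]mulrC -mulrBr ME.
  case: (B j k) => a b; rewrite /cis; simpc; congr (_ +i* _)%C; rewrite /=; ring.
rewrite -scalemxAr -scalemxAl trmxCK mulmxBr mulmxBl.
rewrite eX (conj_mulmx _ _ UV) (conj_mulmx _ _ UV); reflexivity.
Qed.

End Exponential.

(** * Velocity of curves of projections *)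

Lemma orthproj_rdot (R : realType) (n : nat) (P : 'M[R[i]]_n) u v :
  orthproj P -> rdot u (P *m v) = rdot (P *m u) (P *m v).
Proof. by move=> [P1 P2]; rewrite rdot_adj P1 -{1}P2 -mulmxA -{1}P1 -rdot_adj. Qed.

Lemma orthproj_compl (R : realType) (n : nat) (P : 'M[R[i]]_n) :
  orthproj P -> orthproj (1%:M - P).
Proof.
move=> [P1 P2]; split; first by rewrite trmxCB trmxC1 P1.
by rewrite mulmxBr mulmx1 mulmxBl mul1mx P2 subrr subr0.
Qed.

Lemma orthproj_compl_rdot (R : realType) (n : nat) (P : 'M[R[i]]_n) v :
  orthproj P -> rdot (v - P *m v) (v - P *m v) = rdot v v - rdot v (P *m v).
Proof.
move=> hP; have := orthproj_rdot v v (orthproj_compl hP).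
by rewrite mulmxBl mul1mx => <-; rewrite rdotBr.
Qed.

Lemma orthproj_le (R : realType) (n : nat) (P : 'M[R[i]]_n) v :
  orthproj P -> rdot v (P *m v) <= rdot v v.
Proof. by move=> /(orthproj_compl_rdot v) h; rewrite -subr_ge0 -h rdot_ge0. Qed.

Section Velocity.
Context (R : realType) (n : nat) (h : R -> 'M[R[i]]_n) (a b t : R).
Hypotheses (sh : smooth_mx h) (tab : t \in `]a, b[)
  (ph : forall s, s \in `]a, b[ -> orthproj (h s)).

Let D := mxderive h t.

Let is_derive_h u v : is_derive t 1 (fun s => rdot u (h s *m v)) (rdot u (D *m v)).
Proof. exact/mxderive_rdot/smooth_mxderivable. Qed.

Let ab : a <= b.
Proof. by move: tab; rewrite in_itv /= => /andP[at_ tb]; apply/ltW/(lt_trans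
  at_ tb). Qed.

Let der u v s : derivable (fun s => rdot u (h s *m v)) s 1.
Proof. by have [] := mxderive_rdot u v (smooth_mxderivable s sh). Qed.

Lemma velocity_sym u v : rdot u (D *m v) = rdot v (D *m u).
Proof.
rewrite -(@derive_val _ _ _ _ _ _ _ (is_derive_h u v)).
rewrite -(@derive_val _ _ _ _ _ _ _ (is_derive_h v u)).
apply: near_eq_derive; near=> s.
have /ph[hs _] : s \in `]a, b[ by near: s; exact: near_in_itvoo.
by rewrite rdot_adj hs rdotC.
Unshelve. all: by end_near. Qed.

(* On a projection valued curve, [s |-> rdot v (h s *m v)] is maximal at [t] when
   [v] is in the range of [h t], and minimal there when [v] is in its kernel. *)
Lemma velocity_range v : h t *m v = v -> rdot v (D *m v) = 0.
Proof.
move=> hv; rewrite -(@derive_val _ _ _ _ _ _ _ (is_derive_h v v)).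
apply: derive_val; apply: (derive1_at_max ab) => // s sab /=.
by rewrite hv orthproj_le //; exact: ph.
Qed.

Lemma velocity_ker v : h t *m v = 0 -> rdot v (D *m v) = 0.
Proof.
move=> hv; rewrite -(@derive_val _ _ _ _ _ _ _ (is_derive_h v v)).
apply: derive_val; apply: (derive1_at_min ab) => // s sab /=.
by rewrite hv rdot0r orthproj_rdot ?rdot_ge0 //; exact: ph.
Qed.

(** If phi is the angle between [v] and the range of [h t], then x = cos (2 phi) and the square root
    is sin (2 phi), so this is |phi'| <= ||D|| in a form that still makes sense at phi = 0 and phi =
    pi / 2. The diagonal blocks of [D] contribute nothing; the two off-diagonal ones contribute
    equally, with |y| = cos phi and |z| = sin phi. *)
Lemma velocity_bound v x : rdot v v = 1 -> x = 2 * rdot v (h t *m v) - 1 ->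
  `|2 * rdot v (D *m v)| <= 2 * opnorm D * Num.sqrt (1 - x ^+ 2).
Proof.
move=> v1 hx; have ht := ph tab; have [h1 h2] := ht.
set y := h t *m v; set z := v - y.
have vyz : v = y + z by rewrite addrC subrK.
have hy : h t *m y = y by rewrite mulmxA h2.
have hz : h t *m z = 0 by rewrite mulmxBr hy subrr.
have y2 : vnorm y ^+ 2 = rdot v y by rewrite vnorm_sqr -orthproj_rdot.
have z2 : vnorm z ^+ 2 = 1 - rdot v y by rewrite vnorm_sqr orthproj_compl_rdot // v1.
have -> : rdot v (D *m v) = 2 * rdot z (D *m y).
  rewrite vyz mulmxDr rdotDl !rdotDr velocity_range // velocity_ker //.
  by rewrite velocity_sym; ring.
have -> : Num.sqrt (1 - x ^+ 2) = 2 * (vnorm z * vnorm y).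
  rewrite (_ : 1 - x ^+ 2 = (2 * (vnorm z * vnorm y)) ^+ 2).
    by rewrite sqrtr_sqr ger0_norm // !mulr_ge0 // vnorm_ge0.
  by rewrite !exprMn y2 z2 hx; ring.
have : `|rdot z (D *m y)| <= vnorm z * (opnorm D * vnorm y).
  rewrite (le_trans (CauchySchwarz_norm _ _)) // ler_wpM2l ?vnorm_ge0 //.
  exact: vnorm_opnorm.
by rewrite !normrM normr_nat => H; nra.
Qed.

End Velocity.

Lemma smooth_continuous (R : realType) (f : R -> R) : smooth_fun f -> continuous f.
Proof.
by move=> sf t; apply/differentiable_continuous/derivable1_diffP; exact:
  smooth_derivable.
Qed.

Lemma speed_continuous (R : realType) (n : nat) (h : R -> 'M[R[i]]_n) :
  smooth_mx h -> continuous (fun t => opnorm (mxderive h t)).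
Proof.
move=> sh t; apply/cvgrPdist_lt => e e0.
(* The limit is 0, written in the shape of [entry_sum] so that limits can be taken term by term. *)
have : (fun s => 2 * entry_sum (mxderive h t - mxderive h s)) @ t -->
    2 * (\sum_(j < n) \sum_(k < n) (`|0 : R| + `|0 : R|)).
  apply: cvgMl_tmp.
  apply: cvg_big => [|j _]; first exact: add_continuous.
  apply: cvg_big => [|k _]; first exact: add_continuous.
  have [sR sI] := sh j k; under eq_fun do rewrite !mxE /=.
  have dist0 (f : R -> R) : smooth_fun f -> `|derive1 f t - derive1 f s| @[s
    --> t] --> `|0 : R|.
    move=> sf; have c : derive1 f t - derive1 f s @[s --> t] --> derive1 f t -
      derive1 f t.
      by apply: cvgB; [exact: cvg_cst|exact/smooth_continuous/smooth_derive].
    by rewrite subrr in c; exact: cvg_norm c.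
  by apply: cvgD; exact: dist0.
rewrite normr0 addr0 big1 ?mulr0 => [|j _]; last by rewrite big1.
move=> /cvgr_lt/(_ e e0) H; near=> s.
by apply: le_lt_trans (opnorm_dist _ _) _; near: s; exact: H.
Unshelve. all: by end_near. Qed.

(** * Arc length *)

Definition arclength (R : realType) (n : nat) (f : R -> 'M[R[i]]_n) (a b : R)
    : \bar R :=
  (\int[@lebesgue_measure R]_(t in `[a, b]) (opnorm (mxderive f t))%:E)%E.

Definition speed (R : realType) (n : nat) (f : R -> 'M[R[i]]_n) (t : R) : R :=
  opnorm (mxderive f t).

(** Induction on the number of pieces, cutting an interval at the last break point inside it. It
    carries measurability of the speed, the length at constant speed and the angle bound from smooth
    pieces to arbitrary subintervals. *)
Lemma piecewise_chain (R : realType) (N : nat) (s : nat -> R) (Q : R -> R -> Prop) :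
  s 0%N = 0 -> s N = 1 -> (forall l, (l < N)%N -> s l < s l.+1) ->
  (forall a b c, a <= b -> b <= c -> Q a b -> Q b c -> Q a c) ->
  (forall l a b, (l < N)%N -> s l <= a -> a <= b -> b <= s l.+1 -> Q a b) ->
  forall a b, 0 <= a -> a <= b -> b <= 1 -> Q a b.
Proof.
move=> s0 sN sS Qtrans Qs.
have N0 : (0 < N)%N by case: N sN {sS Qs} => //; rewrite s0 => /eqP; rewrite
  eq_sym oner_eq0.
suff h l : (0 < l <= N)%N -> forall a b, 0 <= a -> a <= b -> b <= s l -> Q a b.
  by move=> a b a0 ab b1; apply: (h N) => //; rewrite ?N0 ?leqnn ?sN.
elim: l => // l IH /= lN a b a0 ab bs.
have [l0|l0] := posnP l; first by subst l; apply: (Qs 0%N) => //; rewrite s0.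
have [asl|sla] := leP (s l) a; first exact: (Qs l).
have [bsl|slb] := leP b (s l); first by apply: IH => //; rewrite l0 ltnW.
apply: (Qtrans _ (s l)); [exact: ltW|exact: ltW| |].
- by apply: IH => //; [rewrite l0 ltnW|exact: ltW].
- by apply: (Qs l) => //; exact: ltW.
Qed.

(** Near an interior point [g] and [h] coincide, hence so do their derivatives. At [a] and [b] the
    curve [g] may have no derivative, but adding two points to the interval preserves
    measurability. *)
Lemma speed_measurable_piece (R : realType) (n : nat) (g h : R -> 'M[R[i]]_n)
  (a b : R) :
  smooth_mx h -> {in `]a, b[, g =1 h} ->
  {in `]a, b[, speed g =1 speed h} /\ measurable_fun `[a, b] (speed g).
Proof.
move=> sh gh; have E : {in `]a, b[, speed g =1 speed h}.
  move=> t tab; rewrite /speed.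
  have hg : \forall r \near t, h r = g r.
    by near=> r; rewrite gh //; near: r; exact: near_in_itvoo.
  by have [_ ->] := near_mxderive hg (smooth_mxderivable t sh).
split=> //; apply: (@measurable_fun_itv_cc _ _ _ false true).
have mh : measurable_fun `]a, b[ (speed h).
  by apply: measurable_funTS; apply: continuous_measurable_fun; exact:
    speed_continuous.
by apply: eq_measurable_fun mh => t; rewrite inE /= => /E/esym.
Unshelve. all: by end_near. Qed.

Lemma arclength_add (R : realType) (n : nat) (g : R -> 'M[R[i]]_n) (a b c : R) :
  a <= b -> b <= c -> measurable_fun `[a, b] (speed g) ->
  measurable_fun `[b, c] (speed g) ->
  measurable_fun `[a, c] (speed g) /\
  (arclength g a c = arclength g a b + arclength g b c)%E.
Proof.
move=> ab bc mab mbc.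
have mbc' : measurable_fun `]b, c] (speed g).
  by apply: measurable_funS mbc => //; exact: subset_itv_oc_cc.
have U : `[a, c]%classic = `[a, b] `|` `]b, c] :> set R.
  by apply: itv_bndbnd_setU; rewrite bnd_simp.
have mac : measurable_fun `[a, c] (speed g) by rewrite U; apply/measurable_funU.
split=> //; rewrite /arclength U ge0_integral_setU //=.
- by congr (_ + _)%E; apply: integral_itv_obnd_cbnd; apply/measurable_EFinP.
- by rewrite -U; apply/measurable_EFinP.
- by move=> t _; rewrite lee_fin opnorm_ge0.
- rewrite disj_set2E; apply/eqP/seteqP; split=> // t [] /=; rewrite !in_itv /=.
  by move=> /andP[_ tb] /andP[bt _]; have := lt_le_trans bt tb; rewrite ltxx.
Qed.

Lemma piecewise_speed_measurable (R : realType) (n : nat) (g : R -> 'M[R[i]]_n)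
  (a b : R) :
  piecewise_smooth g -> 0 <= a -> a <= b -> b <= 1 ->
  measurable_fun `[a, b] (speed g).
Proof.
move=> [N [s [s0 sN sS gs]]] a0 ab b1.
move: a b a0 ab b1; apply: (piecewise_chain s0 sN sS) => [a b c ab bc mab mbc|l
  a b lN sa ab bs].
  by have [] := arclength_add ab bc mab mbc.
have [h [sh gh]] := gs _ lN.
have [] // := @speed_measurable_piece R n g h a b sh.
move=> t; rewrite in_itv /= => /andP[at_ tb]; apply: gh.
by rewrite (le_trans sa (ltW at_)) (le_trans (ltW tb) bs).
Qed.

Lemma constant_speed_arclength (R : realType) (n : nat) (g : R -> 'M[R[i]]_n)
  (c a b : R) :
  piecewise_smooth g ->
  (forall t, 0 < t < 1 -> mxderivable g t -> opnorm (mxderive g t) = c) ->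
  0 <= a -> a <= b -> b <= 1 -> arclength g a b = (c * (b - a))%:E.
Proof.
move=> pg gc; have mg := piecewise_speed_measurable pg.
have [N [s [s0 sN sS gs]]] := pg.
(* The bounds on [a] and [b] are made part of the predicate because [piecewise_chain] does not pass
   them on to subintervals. *)
suff : forall a b, 0 <= a -> a <= b -> b <= 1 ->
    (0 <= a /\ b <= 1 -> arclength g a b = (c * (b - a))%:E).
  by move=> H a0 ab b1; apply: H.
move=> {a b}; apply: (piecewise_chain s0 sN sS)
  => [a b d ab bd gab gbd [a0 d1]|l a b lN sa ab bs [a0 b1]].
  have b1 := le_trans bd d1; have b0 := le_trans a0 ab.
  have [_ ->] := arclength_add ab bd (mg _ _ a0 ab b1) (mg _ _ b0 bd d1).
  by rewrite gab // gbd // -EFinD; congr EFin; ring.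
have [h [sh gh]] := gs _ lN.
have ghab : {in `]a, b[, g =1 h}.
  move=> t; rewrite in_itv /= => /andP[at_ tb]; apply: gh.
  by rewrite (le_trans sa (ltW at_)) (le_trans (ltW tb) bs).
have [E _] := speed_measurable_piece sh ghab.
have C : {in `]a, b[, speed g =1 cst c}.
  move=> t tab; apply: gc.
    by move: tab; rewrite in_itv /= => /andP[at_ tb]; rewrite (le_lt_trans a0
      at_) (lt_le_trans tb b1).
  have hg : \forall r \near t, h r = g r.
    by near=> r; rewrite ghab //; near: r; exact: near_in_itvoo.
  by have [] := near_mxderive hg (smooth_mxderivable t sh).
rewrite /arclength (@eq_integral_itv_bounded _ _ _ (cst c)) //.
- rewrite -[LHS]/(\int[@lebesgue_measure R]_(z in `[a, b]) cst c%:E z)%E.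
  rewrite integral_cst; last exact: measurable_itv.
  rewrite /= lebesgue_measure_itv /= lte_fin; have [ba|ba|->] := ltgtP a b.
  + by rewrite -EFinD -EFinM.
  + by have := lt_le_trans ba ab; rewrite ltxx.
  + by rewrite subrr mulr0 mule0.
- apply: measurable_funS (mg _ _ a0 ab b1) => //; exact: subset_itv_oo_cc.
Unshelve. all: by end_near. Qed.

(** * Length bounds the angle *)

(* [cos (2 phi)], where [phi] is the angle between the unit vector [v] and the
   range of the projection [P]. *)
Definition cos_2angle (R : realType) (n : nat) (P : 'M[R[i]]_n)
    (v : 'cV[R[i]]_n) : R :=
  2 * rdot v (P *m v) - 1.

Lemma cos_2angle_bound (R : realType) (n : nat) (P : 'M[R[i]]_n) v :
  orthproj P -> rdot v v = 1 -> -1 <= cos_2angle P v <= 1.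
Proof.
move=> hP v1; have := orthproj_le v hP; have := rdot_ge0 (P *m v).
by rewrite -orthproj_rdot // v1 /cos_2angle => h1 h2; apply/andP; split; lra.
Qed.

Lemma scaled_bound (R : realType) (r x : R) : 0 < r < 1 -> -1 <= x <= 1 -> -1 <
  r * x < 1.
Proof. by move=> /andP[r0 r1] /andP[h1 h2]; apply/andP; split; nra. Qed.

(* The angle itself is not differentiable where [cos_2angle] is [1] or
   [-1]; shrinking [cos_2angle] by a factor [r < 1] makes it so, without
   increasing the speed. *)
Lemma angle_piece (R : realType) (n : nat) (g h : R -> 'M[R[i]]_n) a b v r :
  a < b -> smooth_mx h -> (forall t, a <= t <= b -> g t = h t) ->
  (forall t, a <= t <= b -> orthproj (g t)) -> rdot v v = 1 -> 0 < r < 1 ->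
  ((asin (r * cos_2angle (g a) v) - asin (r * cos_2angle (g b) v))%:E
    <= 2%:E * arclength g a b)%E.
Proof.
move=> ab sh gh pg v1 r01; have /andP[r0 r1] := r01.
pose x t := cos_2angle (h t) v.
have xE t : a <= t <= b -> cos_2angle (g t) v = x t by move=> /gh ->.
have xb t : a <= t <= b -> -1 <= x t <= 1.
  by move=> tab; rewrite -xE //; apply: cos_2angle_bound => //; exact: pg.
have rx t : a <= t <= b -> -1 < r * x t < 1 by move=> /xb; exact: scaled_bound.
have sx : smooth_fun x.
  rewrite /x /cos_2angle; under eq_fun do rewrite -[- 1]mul1r.
  apply: (@smooth_lin2 _ _ (cst (-1))); last exact: smooth_cst.
  by have /smooth_mx_rdot := sh; apply.
have dx t : derive1 x t = 2 * rdot v (mxderive h t *m v).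
  rewrite derive1E; apply: derive_val; rewrite /x /cos_2angle.
  under eq_fun do rewrite -[- 1]mul1r.
  rewrite -[X in is_derive _ _ _ X]addr0 -[X in _ + X](mul1r 0).
  apply: (@is_derive_lin2 _ _ (cst (-1))).
  exact/mxderive_rdot/smooth_mxderivable.
(* [k] is the derivative of [- asin (r * x)]. As the arcsine of cos (2 phi) is pi / 2 - 2 phi, the
   function [- asin x] grows like twice the angle; hence the sign here and the factor 2 in front of
   the length. *)
pose k t := - (r * derive1 x t) / Num.sqrt (1 - (r * x t) ^+ 2).
have den t : a <= t <= b -> 0 < 1 - (r * x t) ^+ 2.
  by move=> /rx/andP[h1 h2]; nra.
have ider t : a <= t <= b -> is_derive t 1 (fun s => - asin (r * x s)) (k t).
  move=> tab; have da := is_derive1_asin (rx _ tab).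
  have drx : is_derive t 1 (fun s => r * x s) (r * derive1 x t).
    by have := smooth_is_derive t sx => dxt; exact: (@is_deriveZ _ _ _ x r).
  have dc := @is_derive1_comp R asin (fun s => r * x s) t _ _ da drx.
  rewrite (_ : k t = - ((Num.sqrt (1 - (r * x t) ^+ 2))^-1 * (r * derive1 x t))).
    exact: (@is_deriveN _ _ _ (asin \o (fun s => r * x s))).
  by rewrite /k mulNr mulrC.
have ck t : a <= t <= b -> {for t, continuous k}.
  move=> tab; rewrite /k.
  apply: (@cvgM _ _ _ _ (fun t => - (r * derive1 x t))).
    by apply: cvgN; apply: cvgMl_tmp; exact/smooth_continuous/smooth_derive.
  apply: cvgV; first by rewrite gt_eqF // sqrtr_gt0 den.
  apply: continuous_comp; last exact: sqrt_continuous.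
  apply: cvgB; first exact: cvg_cst.
  rewrite expr2; under eq_fun do rewrite expr2.
  by apply: cvgM; apply: cvgMl_tmp; exact: smooth_continuous.
have ck_in : {within `[a, b], continuous k}.
  by apply: continuous_in_subspaceT => t; rewrite inE /= in_itv; exact: ck.
have FTC : (\int[@lebesgue_measure R]_(t in `[a, b]) (k t)%:E =
    (- asin (r * x b))%:E - (- asin (r * x a))%:E)%E.
  apply: (@continuous_FTC2 _ k (fun s => - asin (r * x s))) => //.
    have c t : a <= t <= b -> {for t, continuous (fun s => - asin (r * x s))}.
      by move=> /ider[d _]; apply/differentiable_continuous/derivable1_diffP.
    split.
    - by move=> t /subset_itv_oo_cc; rewrite in_itv => /ider[].
    - by apply: cvg_at_right_filter; apply: c; rewrite lexx ltW.
    - by apply: cvg_at_left_filter; apply: c; rewrite lexx ltW.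
  by move=> t /subset_itv_oo_cc; rewrite in_itv derive1E => /ider[].
rewrite !xE ?lexx ?(ltW ab) //.
rewrite (_ : (_ - _)%:E = (- asin (r * x b))%:E - (- asin (r * x a))%:E)%E;
  last first.
  by rewrite -EFinB opprK addrC.
rewrite -FTC.
have ghab : {in `]a, b[, g =1 h}.
  by move=> t /subset_itv_oo_cc; rewrite in_itv; exact: gh.
have [E mg] := speed_measurable_piece sh ghab.
have cs := speed_continuous sh.
have mh : measurable_fun `]a, b[ (speed h).
  by apply: measurable_funTS; exact: continuous_measurable_fun.
have mk : measurable_fun `[a, b] k by exact: subspace_continuous_measurable_fun.
have -> : arclength g a b = (\int[@lebesgue_measure R]_(t in `]a, b[) (speed h
  t)%:E)%E.
  rewrite /arclength integral_itv_bndoo.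
    apply: eq_integral => t; rewrite inE => /E; rewrite /speed => ->; reflexivity.
  by apply/measurable_EFinP; apply: measurable_funS mg => //; exact:
    subset_itv_oo_cc.
rewrite -ge0_integralZl; last 4 first.
- exact: measurable_itv.
- by apply/measurable_EFinP.
- by move=> t _; rewrite lee_fin opnorm_ge0.
- by [].
rewrite integral_itv_bndoo; last first.
  by apply/measurable_EFinP; apply: measurable_funS mk => //; exact:
    subset_itv_oo_cc.
have int (f : R -> R) : {within `[a, b], continuous f} ->
    (@lebesgue_measure R).-integrable `]a, b[ (EFin \o f).
  move=> cf; have := continuous_compact_integrable (@segment_compact _ a b) cf.
  by apply: integrableS; [exact: measurable_itv|exact: measurable_itv|exact:
    subset_itv_oo_cc].
under [leRHS]eq_integral do rewrite -EFinM.
have c2 : {within `[a, b], continuous (fun t => 2 * speed h t)}.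
  by apply: continuous_subspaceT => t; apply: cvgMl_tmp; exact: cs.
apply: (le_integral _ (int _ ck_in) (int _ c2)); first exact: measurable_itv.
move=> t; rewrite inE /= => tab; rewrite lee_fin.
have tab' : a <= t <= b by have := subset_itv_oo_cc tab; rewrite in_itv.
have ph s : s \in `]a, b[ -> orthproj (h s).
  by move=> /[dup] /ghab <- /subset_itv_oo_cc; rewrite in_itv; exact: pg.
have := @velocity_bound R n h a b t sh tab ph v (x t) v1 erefl.
rewrite -dx -/(speed h t) => B.
have s0 : 0 <= speed h t by exact: opnorm_ge0.
apply: (le_trans (ler_norm _)).
have -> : `|k t| = r * `|derive1 x t| / Num.sqrt (1 - (r * x t) ^+ 2).
  by rewrite /k normrM normrN normrM (gtr0_norm r0) normfV (ger0_norm (sqrtr_ge0 _)).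
rewrite ler_pdivrMr ?sqrtr_gt0 ?den //.
(* Shrinking does not increase the speed: [r < 1] reduces the numerator of [k], and passing from [x]
   to [r * x] enlarges its denominator. *)
have le1 : Num.sqrt (1 - (x t) ^+ 2) <= Num.sqrt (1 - (r * x t) ^+ 2).
  by rewrite ler_wsqrtr // lerD2l lerN2 exprMn ler_piMl ?sqr_ge0 // expr2; nra.
have q0 := sqrtr_ge0 (1 - (x t) ^+ 2).
rewrite (le_trans (_ : _ <= 1 * `|derive1 x t|)) ?ler_wpM2r ?(ltW r1) // mul1r.
by rewrite (le_trans B) // ler_wpM2l // mulr_ge0.
Qed.

Lemma angle_arclength (R : realType) (n : nat) (g : R -> 'M[R[i]]_n) a b v r :
  piecewise_smooth g -> (forall t, 0 <= t <= 1 -> orthproj (g t)) ->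
  rdot v v = 1 -> 0 < r < 1 -> 0 <= a -> a <= b -> b <= 1 ->
  ((asin (r * cos_2angle (g a) v) - asin (r * cos_2angle (g b) v))%:E
    <= 2%:E * arclength g a b)%E.
Proof.
move=> pg projg v1 r01; have mg := piecewise_speed_measurable pg.
have [N [s [s0 sN sS gs]]] := pg.
suff : forall a b, 0 <= a -> a <= b -> b <= 1 -> (0 <= a /\ b <= 1 ->
    ((asin (r * cos_2angle (g a) v) - asin (r * cos_2angle (g b) v))%:E
      <= 2%:E * arclength g a b)%E).
  by move=> H a0 ab b1; apply: H.
move=> {a b}; apply: (piecewise_chain s0 sN sS)
  => [a b d ab bd gab gbd [a0 d1]|l a b lN sa ab bs [a0 b1]].
  have b1 := le_trans bd d1; have b0 := le_trans a0 ab.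
  have [_ ->] := arclength_add ab bd (mg _ _ a0 ab b1) (mg _ _ b0 bd d1).
  have pos u w : (0 <= arclength g u w)%E.
    by apply: integral_ge0 => t _; rewrite lee_fin opnorm_ge0.
  rewrite ge0_muleDr // -(subrKA (asin (r * cos_2angle (g b) v))) EFinD.
  by apply: leeD; [exact: gab|exact: gbd].
have [h [sh gh]] := gs _ lN.
have [ab'|ba|->] := ltgtP a b; last 2 first.
- by have := lt_le_trans ba ab; rewrite ltxx.
- rewrite subrr mule_ge0 //.
  by apply: integral_ge0 => t _; rewrite lee_fin opnorm_ge0.
apply: (@angle_piece R n g h) => // t /andP[at_ tb].
- by apply: gh; rewrite (le_trans sa at_) (le_trans tb bs).
- by apply: projg; rewrite (le_trans a0 at_) (le_trans tb b1).
Qed.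

(* Letting the shrinking factor tend to 1. *)
Lemma cos_2angle_ge (R : realType) (n : nat) (g : R -> 'M[R[i]]_n) a b v l :
  piecewise_smooth g -> (forall t, 0 <= t <= 1 -> orthproj (g t)) ->
  rdot v v = 1 -> 0 <= a -> a <= b -> b <= 1 -> arclength g a b = l%:E ->
  0 <= l -> l < pi / 2 -> g a *m v = v -> cos (2 * l) <= cos_2angle (g b) v.
Proof.
move=> pg projg v1 a0 ab b1 gl l0 lpi gav.
have pi0 := @pi_gt0 R.
have xa : cos_2angle (g a) v = 1 by rewrite /cos_2angle gav v1; ring.
have xb : -1 <= cos_2angle (g b) v <= 1.
  by apply: cos_2angle_bound => //; apply: projg; rewrite b1 (le_trans a0 ab).
set x := cos_2angle (g b) v in xb *.
(* The shrinking factor is taken to be [cos e], since its arcsine is pi / 2 - e: the angle bound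
   then reads [F e <= 0]. The condition e < pi - 2 l keeps pi / 2 - (2 l + e) in the interval where
   sine is increasing. *)
pose F e := cos (2 * l + e) - cos e * x.
have F_le0 e : 0 < e -> e < pi / 2 -> e < pi - 2 * l -> F e <= 0.
  move=> e0 epi el.
  have ce : 0 < cos e < 1.
    rewrite cos_gt0_pihalf /=; last by apply/andP; split; lra.
    by rewrite -[X in _ < X]cos0 ltr_cos ?in_itv /=; lra.
  have rx := scaled_bound ce xb; have /andP[rx1 rx2] := rx.
  have := angle_arclength pg projg v1 ce a0 ab b1.
  rewrite gl xa mulr1 -EFinM lee_fin -/x.
  have -> : asin (cos e) = pi / 2 - e.
    rewrite (_ : cos e = sin (pi / 2 - e)) ?sinK ?in_itv /=.
    - by [].
    - by apply/andP; split; lra.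
    - by rewrite sinB sin_pihalf cos_pihalf; ring.
  move=> h; rewrite /F subr_le0 -[leRHS]asinK ?in_itv /=; last by rewrite !ltW.
  have -> : cos (2 * l + e) = sin (pi / 2 - (2 * l + e)).
    by rewrite sinB sin_pihalf cos_pihalf; ring.
  have cx : -1 <= cos e * x <= 1 by rewrite !ltW.
  have a1 := asin_geNpi2 cx; have a2 := asin_lepi2 cx.
  by rewrite leNgt ltr_sin ?in_itv /= -?leNgt; try (apply/andP; split); lra.
have cF : F e @[e --> 0^'+] --> F 0.
  apply: cvg_at_right_filter; apply: cvgB.
    apply: continuous_comp; last exact: continuous_cos.
    by apply: cvgD; [exact: cvg_cst|exact: cvg_id].
  by apply: cvgMr_tmp; exact: continuous_cos.
have : F 0 <= 0.
  rewrite -(cvg_lim _ cF) //; apply: limr_le; first exact: cvgP cF.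
  near=> e; apply: F_le0; near: e; first exact: nbhs_right_gt.
    by apply: nbhs_right_lt; lra.
  by apply: nbhs_right_lt; lra.
by rewrite /F addr0 cos0 mul1r subr_le0.
Unshelve. all: by end_near. Qed.

(** * Equality case *)

Lemma cos_2angle_sqr (R : realType) (n : nat) (P : 'M[R[i]]_n) v :
  orthproj P -> cos_2angle P v = 2 * vnorm (P *m v) ^+ 2 - 1.
Proof. by move=> hP; rewrite /cos_2angle vnorm_sqr -orthproj_rdot. Qed.

Lemma cos_double (R : realType) (x : R) : cos (2 * x) = 2 * cos x ^+ 2 - 1.
Proof. by rewrite mulr_natl cos_mulr2n -mulr_natl. Qed.

(** If the length were some [l < th], then [cos_2angle_ge] would give cos (2 l) <= cos (2 th),
    against the strict decrease of cosine on [0, pi]. *)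
Lemma curve_length_ge (R : realType) (n : nat) (P Q : 'M[R[i]]_n)
    (f : R -> 'M[R[i]]_n) th v :
  grass_curve P Q f -> rdot v v = 1 -> P *m v = v -> 0 <= th < pi / 2 ->
  cos_2angle Q v <= cos (2 * th) -> (th%:E <= curve_length f)%E.
Proof.
move=> [pf projf f0 f1] v1 Pv /andP[th0 thpi] hQ.
have pi0 := @pi_gt0 R.
have L0 : (0 <= curve_length f)%E by apply: integral_ge0 => t _; rewrite
  lee_fin opnorm_ge0.
case E : (curve_length f) L0 => [l| |] // L0; last by rewrite leey.
rewrite lee_fin leNgt; apply/negP => lth; rewrite lee_fin in L0.
have fv : f 0 *m v = v by rewrite f0.
have := cos_2angle_ge pf projf v1 (lexx 0) ler01 (lexx 1) E L0 (lt_trans lth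
  thpi) fv.
rewrite f1 => h; have := le_trans h hQ.
by rewrite leNgt ltr_cos ?in_itv /=; try (apply/andP; split); lra.
Qed.

Lemma ge0_sum3_eq0 (R : realType) (x y z : R) :
  0 <= - x - y - z -> 0 <= x -> 0 <= y -> 0 <= z -> x = 0 /\ z = 0.
Proof. by move=> *; split; lra. Qed.

Lemma cos_gt0_acute (R : realType) (x : R) : 0 < x < pi / 2 -> 0 < cos x.
Proof. by move=> /andP[x0 xpi]; apply: cos_gt0_pihalf; apply/andP; split; lra. Qed.

Lemma arc_split (R : realType) (th t : R) : 0 < th < pi / 2 -> 0 < t < 1 ->
  [/\ th = t * th + (1 - t) * th, 0 < t * th < pi / 2 & 0 < (1 - t) * th < pi / 2].
Proof.
move=> /andP[th0 thpi] /andP[t0 t1]; have p0 : 0 < t * th by rewrite mulr_gt0.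
have q0 : 0 < (1 - t) * th by rewrite mulr_gt0 // subr_gt0.
have e : th = t * th + (1 - t) * th by ring.
by split=> //; apply/andP; split; lra.
Qed.

Lemma double_sqr_le (R : realType) (x c : R) : 0 <= x -> 0 <= c ->
  (2 * c ^+ 2 - 1 <= 2 * x ^+ 2 - 1) = (c <= x).
Proof. by move=> x0 c0; rewrite lerD2r ler_pM2l // ler_pXn2r. Qed.

(* Equality case of the triangle inequality on the unit sphere: if [t + s] is the
   angle between [v] and [w] then a unit vector at angles at most [t] and [s] from
   them is on the great circle arc joining them. *)
Lemma slerp (R : realType) (n : nat) (u v w : 'cV[R[i]]_n) (t s : R) :
  rdot u u = 1 -> rdot v v = 1 -> rdot w w = 1 ->
  0 < t < pi / 2 -> 0 < s < pi / 2 -> 0 < t + s < pi / 2 ->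
  cos t <= rdot v u -> cos s <= rdot u w -> rdot v w <= cos (t + s) ->
  [/\ rdot v u = cos t, rdot v w = cos (t + s) &
      forall q, sin (t + s) * rdot q u = sin s * rdot q v + sin t * rdot q w].
Proof.
move=> u1 v1 w1 t_itv s_itv ts_itv vu uw vw.
have a0 := sin_gt0_pihalf t_itv; have c0 := sin_gt0_pihalf s_itv.
have S0 := sin_gt0_pihalf ts_itv.
have ab := cos2Dsin2 t; have cd := cos2Dsin2 s.
have eS := sinD t s; have eC := cosD t s.
(* [z = 0] says that [u] is the point of the arc at angle t from [v] and s from [w]. Expanded, its
   squared norm is minus a sum of three terms that the hypotheses make nonnegative, so all of them
   vanish. *)
set z := (sin (t + s))%:C%C *: u - (sin s)%:C%C *: v - (sin t)%:C%C *: w.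
have zz : rdot z z = - (2 * sin (t + s) * sin s * (rdot v u - cos t))
   - 2 * sin (t + s) * sin t * (rdot u w - cos s)
   - 2 * sin s * sin t * (cos (t + s) - rdot v w).
  rewrite /z !(rdotBr, rdotBl, rdotZr, rdotZl) u1 v1 w1.
  rewrite (rdotC u v) (rdotC w u) (rdotC w v).
  apply/eqP; rewrite -subr_eq0; apply/eqP.
  rewrite (_ : _ - _ = - sin t ^+ 2 * (cos s ^+ 2 + sin s ^+ 2 - 1)
     - sin s ^+ 2 * (cos t ^+ 2 + sin t ^+ 2 - 1)); last by rewrite eS eC; ring.
  by rewrite ab cd !subrr !mulr0 subrr.
have z0 := rdot_ge0 z; rewrite zz in z0.
have p1 : 0 <= 2 * sin (t + s) * sin s * (rdot v u - cos t).
  by rewrite !mulr_ge0 ?(ltW S0) ?(ltW c0) // subr_ge0.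
have p2 : 0 <= 2 * sin (t + s) * sin t * (rdot u w - cos s).
  by rewrite !mulr_ge0 ?(ltW S0) ?(ltW a0) // subr_ge0.
have p3 : 0 <= 2 * sin s * sin t * (cos (t + s) - rdot v w).
  by rewrite !mulr_ge0 ?(ltW c0) ?(ltW a0) // subr_ge0.
have [q1 q3] := ge0_sum3_eq0 z0 p1 p2 p3.
have zz0 : rdot z z = 0.
  apply/eqP; rewrite eq_le rdot_ge0 andbT zz q1 q3 subr0 oppr0 add0r oppr_le0.
  exact: p2.
split.
- apply/eqP; rewrite -subr_eq0; move/eqP: q1.
  by rewrite !mulf_eq0 (gt_eqF S0) (gt_eqF c0) pnatr_eq0.
- apply/esym/eqP; rewrite -subr_eq0; move/eqP: q3.
  by rewrite !mulf_eq0 (gt_eqF a0) (gt_eqF c0) pnatr_eq0.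
move=> q; have : rdot q z = 0 by rewrite (rdot_eq0 zz0) rdot0r.
by rewrite /z !(rdotBr, rdotZr) => /eqP; rewrite -addrA -opprD subr_eq0 => /eqP.
Qed.

(** The right-hand side does not involve [f]. It describes the point at angle [t * th] on the arc
    from [v] to [Q v / cos th], scaled by [cos (t * th)], which is the norm of the projection
    [f t *m v]. The vector [q] is a test vector. *)
Lemma rigidity (R : realType) (n : nat) (P Q : 'M[R[i]]_n)
    (f : R -> 'M[R[i]]_n) th v t :
  grass_curve P Q f ->
  (forall t, 0 < t < 1 -> mxderivable f t -> opnorm (mxderive f t) = th) ->
  rdot v v = 1 -> P *m v = v -> 0 < th < pi / 2 -> cos_2angle Q v <= cos (2 * th) ->
  0 <= t <= 1 -> forall q,
  rdot q (f t *m v) = cos (t * th) / sin th *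
    (sin ((1 - t) * th) * rdot q v + sin (t * th) / cos th * rdot q (Q *m v)).
Proof.
move=> [pf projf f0 f1] cf v1 Pv th_itv hQ /andP[t0 t1] q.
have S0 := sin_gt0_pihalf th_itv.
have C0 := cos_gt0_acute th_itv.
(* The endpoints are treated apart because [slerp] needs both partial angles to be positive. *)
have [->|tn0] := eqVneq t 0.
  rewrite f0 Pv mul0r cos0 sin0 subr0 mul1r mul0r mul0r addr0 mulrA mul1r.
  by rewrite mulVf ?mul1r // gt_eqF.
have [->|tn1] := eqVneq t 1.
  rewrite f1 subrr mul0r sin0 mul0r add0r mul1r.
  by field; rewrite !gt_eqF.
have t_gt0 : 0 < t by rewrite lt_neqAle eq_sym tn0.
have t_lt1 : t < 1 by rewrite lt_neqAle tn1.
have tt : 0 < t < 1 by rewrite t_gt0.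
have [] := arc_split th_itv tt; set tau := t * th; set sig := (1 - t) * th.
move=> eth taui sigi; have /andP[tau0 taupi] := taui; have /andP[sig0 sigpi] := sigi.
have ct0 := cos_gt0_acute taui; have cs0 := cos_gt0_acute sigi.
have projt : orthproj (f t) by apply: projf; rewrite t0 t1.
have projQ : orthproj Q by rewrite -f1; apply: projf; rewrite ler01 lexx.
have fv : f 0 *m v = v by rewrite f0.
set y := f t *m v.
have yv : cos tau <= vnorm y.
  have L := constant_speed_arclength pf cf (lexx 0) t0 t1.
  rewrite subr0 [th * t]mulrC -/tau in L.
  have := cos_2angle_ge pf projf v1 (lexx 0) t0 t1 L (ltW tau0) taupi fv.
  by rewrite (cos_2angle_sqr _ projt) cos_double (double_sqr_le (vnorm_ge0 _)
    (ltW ct0)).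
have y0 : 0 < vnorm y by exact: lt_le_trans ct0 yv.
set u := ((vnorm y)^-1)%:C%C *: y.
have unit (x : 'cV[R[i]]_n) : 0 < vnorm x ->
    rdot (((vnorm x)^-1)%:C%C *: x) (((vnorm x)^-1)%:C%C *: x) = 1.
  by move=> x0; rewrite rdotZl rdotZr -vnorm_sqr; field; rewrite gt_eqF.
have u1 : rdot u u = 1 by exact: unit.
have fu : f t *m u = u by rewrite /u -scalemxAr /y mulmxA projt.2.
have vu : rdot v u = vnorm y.
  by rewrite rdotZr orthproj_rdot // -vnorm_sqr; field; rewrite gt_eqF.
have Qu : cos sig <= vnorm (Q *m u).
  have L := constant_speed_arclength pf cf t0 t1 (lexx 1).
  rewrite [th * (1 - t)]mulrC -/sig in L.
  have := cos_2angle_ge pf projf u1 t0 t1 (lexx 1) L (ltW sig0) sigpi fu.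
  by rewrite f1 (cos_2angle_sqr _ projQ) cos_double (double_sqr_le (vnorm_ge0
    _) (ltW cs0)).
have Qu0 : 0 < vnorm (Q *m u) by exact: lt_le_trans cs0 Qu.
set w := ((vnorm (Q *m u))^-1)%:C%C *: (Q *m u).
have w1 : rdot w w = 1 by exact: unit.
have Qw : Q *m w = w by rewrite /w -scalemxAr mulmxA projQ.2.
have uw : rdot u w = vnorm (Q *m u).
  by rewrite rdotZr orthproj_rdot // -vnorm_sqr; field; rewrite gt_eqF.
have Qv : vnorm (Q *m v) <= cos th.
  by move: hQ; rewrite (cos_2angle_sqr _ projQ) cos_double (double_sqr_le (ltW
    C0) (vnorm_ge0 _)).
have vw_Qv : rdot v w = rdot (Q *m v) w by rewrite -{1}Qw orthproj_rdot // Qw.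
have wn : vnorm w = 1 by rewrite vnormE w1 sqrtr1.
have vw : rdot v w <= cos th.
  by rewrite vw_Qv (le_trans (CauchySchwarz _ _)) // wn mulr1.
have := @slerp R n u v w tau sig u1 v1 w1 taui sigi.
rewrite -eth vu uw => /(_ th_itv yv Qu vw)[ey evw /(_ q) eu].
clearbody w.
(* [w] was built from [u], hence from [f]. Now [w] is a unit vector whose product with [Q *m v] is
   [cos th], while [Q *m v] has norm at most [cos th]: this is equality in Cauchy-Schwarz, and [w]
   depends on [v] and [Q] alone. *)
have wQ : w = ((cos th)^-1)%:C%C *: (Q *m v).
  apply/eqP; rewrite -subr_eq0; apply/eqP/rdot_eq0/eqP.
  rewrite eq_le rdot_ge0 andbT rdotBl !rdotBr !rdotZl !rdotZr w1.
  rewrite (rdotC w) -vw_Qv evw -vnorm_sqr mulVf ?gt_eqF //.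
  have : (cos th)^-1 * vnorm (Q *m v) <= 1 by rewrite mulrC ler_pdivrMr // mul1r.
  have : 0 <= (cos th)^-1 * vnorm (Q *m v) by rewrite mulr_ge0 ?invr_ge0
    ?vnorm_ge0 ?(ltW C0).
  set k := _ * vnorm _ => k0 k1.
  rewrite (_ : (cos th)^-1 * ((cos th)^-1 * vnorm (Q *m v) ^+ 2) = k ^+ 2);
    last by rewrite /k; ring.
  by rewrite subrr sub0r opprB subr_le0 expr_le1.
have yu : rdot q y = cos tau * rdot q u.
  by rewrite rdotZr -ey; field; rewrite gt_eqF.
clearbody u; move: eu; rewrite yu wQ rdotZr => eu.
rewrite (_ : sin tau / cos th * rdot q (Q *m v) = sin tau * ((cos th)^-1 * rdot
  q (Q *m v))); last by ring.
by rewrite -eu; field; rewrite gt_eqF.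
Qed.

(** * The geodesic e^{itX} P e^{-itX} *)

(** In an eigenbasis the norm is the largest [|d 0 j|], and it is attained at the corresponding
    basis vector. *)
Lemma spectral_norm_eigenvector (R : realType) (n : nat) (X : 'M[R[i]]_n) :
  X^t* = X -> 0 < opnorm X -> exists v : 'cV[R[i]]_n,
    v != 0 /\ X *m (X *m v) = ((opnorm X ^+ 2)%:C)%C *: v.
Proof.
move=> hX X0.
have [U [d [UU UV eX _]]] := expmx_spectral hX.
(* A positive norm excludes [n = 0], where there is no eigenvalue to maximise. *)
have [j0 _|no] := pickP 'I_n; last first.
  have : opnorm X <= 0.
    apply: opnorm_le => // v; rewrite (_ : X *m v = 0) ?vnorm0 ?mul0r //.
    by apply/matrixP => j; have := no j.
  by rewrite leNgt X0.
pose j1 := [arg max_(j > j0) `|d 0 j|]%O.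
have dmax j : `|d 0 j| <= `|d 0 j1|.
  by rewrite /j1; case: Order.TotalTheory.arg_maxP => // l _; apply.
clearbody j1.
have [D eD] : exists D, D = diag_mx (map_mx (real_complex R) d) by eexists.
rewrite -eD in eX.
have D_le w : vnorm (D *m w) <= `|d 0 j1| * vnorm w.
  rewrite -[leRHS]ger0_norm ?mulr_ge0 ?vnorm_ge0 // -sqrtr_sqr vnormE ler_wsqrtr //.
  rewrite exprMn vnorm_sqr !rdotE mulr_sumr; apply: ler_sum => j _.
  rewrite eD mul_diag_mx !mxE ReM ImM /= !mul0r subr0 addr0.
  rewrite (_ : _ + _ = `|d 0 j| ^+ 2 * (complex.Re (w j 0) * complex.Re (w j 0) +
     Im (w j 0) * Im (w j 0))); last by rewrite real_normK ?num_real //; ring.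
  by rewrite ler_wpM2r ?ler_pXn2r ?nnegrE // addr_ge0 // -expr2 sqr_ge0.
have UvV w : vnorm (U^t* *m w) = vnorm w.
  by apply: vnorm_unitary; rewrite trmxCK; exact: UV.
have Uv w : vnorm (U *m w) = vnorm w by apply: vnorm_unitary; exact: UU.
pose e : 'cV[R[i]]_n := delta_mx j1 0.
have De : D *m e = (d 0 j1)%:C%C *: e.
  rewrite eD mul_diag_mx; apply/matrixP => j k; rewrite !mxE.
  by case: (eqVneq j j1) => [->|]; rewrite /= ?mulr0.
have Xe : X *m (U^t* *m e) = (d 0 j1)%:C%C *: (U^t* *m e).
  rewrite eX -(mulmxA _ U) (mulmxA U) UV mul1mx -mulmxA De -scalemxAr; reflexivity.
have e0 : U^t* *m e != 0.
  apply/eqP => h; have := UvV e; rewrite h vnorm0 => /esym/vnorm_eq0.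
  move/matrixP/(_ j1 0); rewrite !mxE !eqxx => /eqP; rewrite oner_eq0; exact: notF.
have eop : opnorm X = `|d 0 j1|.
  apply: (opnorm_eq _ _ e0); first exact: normr_ge0.
    by move=> w; rewrite eX -!mulmxA UvV -(Uv w) D_le.
  by rewrite Xe vnormZ.
exists (U^t* *m e); split; first exact: e0.
rewrite Xe -scalemxAr Xe scalerA -rmorphM eop real_normK ?num_real // expr2.
Qed.

Lemma opnorm_eq0 (R : realType) (n : nat) (X : 'M[R[i]]_n) : opnorm X = 0 -> X = 0.
Proof.
move=> X0; apply: mx_eqP => v; rewrite mul0mx; apply: vnorm_eq0; apply/eqP.
by rewrite eq_le vnorm_ge0 andbT (le_trans (vnorm_opnorm _ _)) // X0 mul0r.
Qed.

(** If X = 0 then |X|^2 = 0, and 0 is the only possible eigenvalue of |X|. *)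
Lemma opnorm_gt0_eigenvalues (R : realType) (n : nat) (X : 'M[R[i]]_n) :
  (exists a b : R[i],
    [/\ a != b, eigenvalue (absmx X) a & eigenvalue (absmx X) b]) -> 0 < opnorm X.
Proof.
move=> [a [b [ab ha hb]]]; rewrite lt_neqAle opnorm_ge0 andbT.
apply/eqP => /esym/opnorm_eq0 X0; move/eqP: ab; apply.
suff ev0 c : eigenvalue (absmx X) c -> c = 0 by rewrite (ev0 a) // (ev0 b).
move=> /eigenvalueP[v hv v0].
have : v *m (absmx X *m absmx X) = (c ^+ 2) *: v.
  by rewrite mulmxA hv -scalemxAl hv scalerA.
rewrite absmx_sqr X0 mulmx0 mulmx0 => /esym/eqP; rewrite scaler_eq0 (negPf v0) orbF.
by rewrite expf_eq0 => /andP[_ /eqP].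
Qed.

(** Trades the square root |X| for the polynomial X^2. For the converse, w = ||X|| v - |X| v
    satisfies |X| w = - ||X|| w, which forces w = 0 because |X| is positive semidefinite. *)
Lemma SX_eigen (R : realType) (n : nat) (X : 'M[R[i]]_n) v :
  X^t* = X -> 0 < opnorm X ->
  SX X v <-> X *m (X *m v) = ((opnorm X ^+ 2)%:C)%C *: v.
Proof.
move=> hX; set th := opnorm X => th0; rewrite /SX /= mulmxBl mul_scalar_mx -/th.
have A2 w : absmx X *m (absmx X *m w) = X *m (X *m w).
  rewrite (mulmxA (absmx X) (absmx X) w) absmx_sqr hX -mulmxA; reflexivity.
split=> [/eqP|h].
  rewrite subr_eq0 => /eqP/esym h; rewrite -A2 h -scalemxAr h scalerA -rmorphM
    -expr2.
  reflexivity.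
set w := _ - _.
have hw : absmx X *m w = (- th)%:C%C *: w.
  rewrite /w mulmxBr A2 h -scalemxAr rmorphN /= scaleNr scalerBr opprB scalerA.
  rewrite -rmorphM -expr2; reflexivity.
apply: rdot_eq0.
have : 0 <= rdot w (absmx X *m w).
  have := absmx_ge0 X w; rewrite -(mulmxA (w^t*) (absmx X) w) lecE => /andP[_].
  exact.
rewrite hw rdotZr mulNr oppr_ge0 pmulr_rle0 // => w0.
by apply/eqP; rewrite eq_le w0 rdot_ge0.
Qed.

Lemma vnormi (R : realType) (n : nat) (v : 'cV[R[i]]_n) :
  vnorm ((0 +i* 1)%C *: v) = vnorm v.
Proof.
rewrite /vnorm; congr Num.sqrt; apply: eq_bigr => j _; rewrite mxE.
by case: (v j 0) => a b; simpc; rewrite /= sqrrN addrC.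
Qed.

Lemma vnorm_reflection (R : realType) (n : nat) (P : 'M[R[i]]_n) v :
  orthproj P -> vnorm (v - P *m v - P *m v) = vnorm v.
Proof.
move=> hP; rewrite !vnormE; congr Num.sqrt.
rewrite !(rdotBl, rdotBr) (rdotC (P *m v) v) (orthproj_rdot v v hP).
by ring.
Qed.

Section Geodesic.
Context (R : realType) (n : nat) (P X : 'M[R[i]]_n).
Hypotheses (hP : orthproj P) (hX : tangent P X) (X0 : 0 < opnorm X).

Let th := opnorm X.
Implicit Types v w : 'cV[R[i]]_n.

(** Tangency says that X is off-diagonal with respect to the range and the kernel of P, a condition
    symmetric in the two; results on the range thus apply to the kernel. *)
Lemma tangent_compl : tangent (1%:M - P) X.
Proof.
have [h1 h2] := hX; split; first exact: h1.
by rewrite mulmxBl mulmxBr mul1mx mulmx1 addrACA -opprD -h2 addrK.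
Qed.

Lemma tangent_ker v : P *m v = v -> P *m (X *m v) = 0.
Proof.
move=> hv; have [_ h2] := hX.
have : X *m v = P *m (X *m v) + X *m v by rewrite {1}h2 mulmxDl -!mulmxA hv.
by move/eqP; rewrite -subr_eq subrr => /eqP/esym.
Qed.

(** X interchanges the range and the kernel of P, so X^2 preserves both. As an eigenspace of X^2,
    [SX X] is therefore stable under P. *)
Lemma tangent_sqr_comm v : P *m (X *m (X *m v)) = X *m (X *m (P *m v)).
Proof.
have [_ h2] := hX.
have PX w : P *m (X *m w) = X *m w - X *m (P *m w).
  by rewrite {2}h2 mulmxDl -!mulmxA addrK.
by rewrite PX (PX v) mulmxBr opprB addrC subrK.
Qed.

Lemma SX_P v : SX X v -> SX X (P *m v).
Proof.
have [h1 _] := hX; move=> /(SX_eigen v h1 X0) hv; apply/(SX_eigen _ h1 X0).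
by rewrite -tangent_sqr_comm hv -scalemxAr.
Qed.

Lemma SX_X v : SX X v -> SX X (X *m v).
Proof.
have [h1 _] := hX; move=> /(SX_eigen v h1 X0) hv; apply/(SX_eigen _ h1 X0).
by rewrite hv -scalemxAr.
Qed.

Lemma SX_vnorm v : SX X v -> vnorm (X *m v) = th * vnorm v.
Proof.
have [h1 _] := hX; move=> /(SX_eigen v h1 X0) hv.
rewrite -(gtr0_norm (X0 : 0 < th)) -sqrtr_sqr !vnormE -sqrtrM ?sqr_ge0 //;
  congr Num.sqrt.
by rewrite rdot_adj h1 hv rdotZl.
Qed.

Lemma SX_neq0 : exists v, SX X v /\ v != 0.
Proof.
have [h1 _] := hX; have [v [v0 hv]] := spectral_norm_eigenvector h1 X0.
by exists v; split=> //; apply/(SX_eigen _ h1 X0).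
Qed.

(** Take a nonzero v in [SX X]. If P v is nonzero, it can be normalised; otherwise v is in the
    kernel of P, and X moves it into the range without killing it, since |X v| = ||X|| |v|. *)
Lemma SX_range_neq0 : exists v, [/\ SX X v, P *m v = v & rdot v v = 1].
Proof.
have [_ h2] := hX; have [_ P2] := hP.
have normalize w : SX X w -> P *m w = w -> w != 0 ->
    exists v, [/\ SX X v, P *m v = v & rdot v v = 1].
  move=> sw Pw /vnorm_gt0 w0; exists ((vnorm w)^-1%:C%C *: w); split.
  - by rewrite /SX /= -scalemxAr sw scaler0.
  - by rewrite -scalemxAr Pw.
  - by rewrite rdotZl rdotZr -vnorm_sqr; field; rewrite gt_eqF.
have [v [sv v0]] := SX_neq0.
have [Pv|Pv] := eqVneq (P *m v) 0; last first.
  by apply: (normalize (P *m v)) => //; [exact: SX_P|rewrite mulmxA P2].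
apply: (normalize (X *m v)); first exact: SX_X.
  by rewrite [in RHS]h2 mulmxDl -!mulmxA Pv mulmx0 addr0.
apply/eqP => Xv; have := SX_vnorm sv; rewrite Xv vnorm0 => /esym/eqP.
by rewrite mulf_eq0 !gt_eqF // vnorm_gt0.
Qed.

(** X commutes with its exponentials, so the relation X = P X + X P can be conjugated by them. *)
Lemma flow_tangent t : tangent (flow P X t) X.
Proof.
have [h1 h2] := hX; split; first exact: h1.
have c1 := expmx_comm h1 t; have c2 := expmx_comm h1 (- t).
have := expmxNK h1 (- t); rewrite opprK /flow; move: c1 c2.
move: (expmx _) (expmx _) => B A c1 c2 AB.
rewrite -(mulmxA _ B) c2 mulmxA (mulmxA X (A *m P)) (mulmxA X A) -c1.
rewrite -(mulmxA A P) -(mulmxA A X) -mulmxDl -mulmxDr -h2 c1 -mulmxA AB mulmx1.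
reflexivity.
Qed.

(** With F the flow, tangency at F gives X F = X - F X, so F' = i (X F - F X) = i (1 - 2 F) X, and
    the reflection 1 - 2 F is an isometry. *)
Lemma flow_velocity t v :
  vnorm (mxderive (flow P X) t *m v) = vnorm (X *m v).
Proof.
have [h1 _] := hX; have [_ ->] := flow_smooth h1 P.
have [_ hF] := flow_tangent t; have pF := flow_orthproj h1 t hP.
rewrite -scalemxAl vnormi -(vnorm_reflection (X *m v) pF).
move: (flow P X t) hF => F hF.
have e : X *m F = X - F *m X.
  by apply/esym/eqP; rewrite subr_eq addrC -hF.
rewrite e (mulmxA F X v) -!mulmxBl; reflexivity.
Qed.

Lemma flow_speed t : opnorm (mxderive (flow P X) t) = th.
Proof.
have [v [sv v0]] := SX_neq0; apply: (opnorm_eq (v := v)) => //.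
- exact: ltW.
- by move=> w; rewrite flow_velocity vnorm_opnorm.
- by rewrite flow_velocity SX_vnorm.
Qed.

Lemma flow_curve : grass_curve P (flow P X 1) (flow P X).
Proof.
have [h1 _] := hX; split.
- exists 1%N, (fun l => l%:R); split=> // [l|l l1]; first by rewrite ltr_nat.
  by exists (flow P X); split=> //; have [] := flow_smooth h1 P.
- by move=> t _; exact: flow_orthproj.
- exact: flow0.
- reflexivity.
Qed.

(** By [expmx_eigen], e^{-iX} v is cos th v plus a multiple of X v; P fixes the first term and kills
    the second, so <Q v, v> = |P e^{-iX} v|^2 = cos^2 th. *)
Lemma flow_cos_2angle v : SX X v -> P *m v = v -> rdot v v = 1 ->
  cos_2angle (flow P X 1) v = cos (2 * th).
Proof.
have [h1 _] := hX; move=> sv Pv v1.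
have hv := (SX_eigen v h1 X0).1 sv.
have := expmx_eigen h1 (-1) (lt0r_neq0 X0) hv.
have := expmx_adj h1 1; rewrite cos_double /cos_2angle /flow.
move: (expmx _) (expmx _) => B A AB Bv.
rewrite -!mulmxA rdot_adj AB orthproj_rdot // Bv.
rewrite mulmxDr -!scalemxAr Pv (tangent_ker Pv) scaler0 addr0.
by rewrite rdotZr rdotZl v1 mulN1r cosN; ring.
Qed.

End Geodesic.

(** * Curves of minimal length on S_X and block decompositions *)

Lemma mxderive_compl (R : realType) (n : nat) (f : R -> 'M[R[i]]_n) t :
  mxderivable f t -> mxderivable (fun s => 1%:M - f s) t /\
  mxderive (fun s => 1%:M - f s) t = - mxderive f t.
Proof.
move=> ft; apply: mxderive_unique => u v.
rewrite mulNmx rdotNr -[X in is_derive _ _ _ X]add0r.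
rewrite (_ : (fun _ => _) = cst (rdot u v) - (fun s => rdot u (f s *m v))).
  by apply: is_deriveB; exact: mxderive_rdot.
by apply/funext => s; rewrite /= mulmxBl mul1mx rdotBr.
Qed.

Lemma opnormN (R : realType) (n : nat) (A : 'M[R[i]]_n) : opnorm (- A) = opnorm A.
Proof.
rewrite /opnorm; congr sup; apply: eq_imagel => v _.
by rewrite mulNmx vnormE rdotNl rdotNr opprK -vnormE.
Qed.

Lemma smooth_compl (R : realType) (n : nat) (f : R -> 'M[R[i]]_n) :
  smooth_mx f -> smooth_mx (fun s => 1%:M - f s).
Proof.
move=> /smooth_mx_rdot sf; apply/smooth_mx_rdot => u v.
under eq_fun do rewrite mulmxBl mul1mx rdotBr -[rdot u v]mul1r -mulN1r.
by apply: smooth_lin2; [exact: smooth_cst|exact: sf].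
Qed.

(** [T] acts on the smooth functions on R that represent [f] on the pieces; [g] is compared with
    them on [0,1] only, where curves are specified. *)
Lemma piecewise_smooth_map (R : realType) (n m : nat) (f : R -> 'M[R[i]]_n)
    (g : R -> 'M[R[i]]_m) (T : (R -> 'M[R[i]]_n) -> R -> 'M[R[i]]_m) :
  (forall h, smooth_mx h -> smooth_mx (T h)) ->
  (forall h t, 0 <= t <= 1 -> f t = h t -> g t = T h t) ->
  piecewise_smooth f -> piecewise_smooth g.
Proof.
move=> Ts fg [N [s [s0 sN sS fs]]]; exists N, s; split=> // l lN.
have [h [sh fh]] := fs l lN; exists (T h); split; first exact: Ts.
have s_le i j : (i <= j <= N)%N -> s i <= s j.
  move=> /andP[ij jN]; elim: j ij jN => [|j IH]; first by rewrite leqn0 => /eqP->.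
  rewrite leq_eqVlt => /predU1P[-> //|ij] jN.
  by rewrite (le_trans (IH _ (ltnW jN))) // ltW // sS.
move=> t /andP[t0 t1]; apply: fg; last by apply: fh; rewrite t0.
rewrite (le_trans _ t0) ?(le_trans t1) // -?s0 -?sN s_le // ?leq0n ?leqnn ?lN //.
exact: ltnW.
Qed.

Lemma curve_compl (R : realType) (n : nat) (P Q : 'M[R[i]]_n) f :
  grass_curve P Q f -> grass_curve (1%:M - P) (1%:M - Q) (fun s => 1%:M - f s).
Proof.
move=> [pf projf f0 f1]; split.
- apply: (piecewise_smooth_map (T := fun h s => 1%:M - h s) _ _ pf); first
  exact: smooth_compl.
  by move=> h t _ ->.
- by move=> t /projf; exact: orthproj_compl.
- by rewrite f0.
- by rewrite f1.
Qed.

Lemma speed_compl (R : realType) (n : nat) (f : R -> 'M[R[i]]_n) c :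
  (forall t, 0 < t < 1 -> mxderivable f t -> opnorm (mxderive f t) = c) ->
  forall t, 0 < t < 1 -> mxderivable (fun s => 1%:M - f s) t ->
    opnorm (mxderive (fun s => 1%:M - f s) t) = c.
Proof.
move=> fc t t01 /mxderive_compl[].
rewrite (_ : (fun s => 1%:M - (1%:M - f s)) = f).
  by move=> ft _; have [_ ->] := mxderive_compl ft; rewrite opnormN fc.
by apply/funext => s; rewrite subKr.
Qed.

Lemma geodesic_unique_range (R : realType) (n : nat) (P X : 'M[R[i]]_n) f v t :
  orthproj P -> tangent P X -> 0 < opnorm X < pi / 2 ->
  grass_curve P (flow P X 1) f ->
  (forall t, 0 < t < 1 -> mxderivable f t -> opnorm (mxderive f t) = opnorm X) ->
  SX X v -> P *m v = v -> 0 <= t <= 1 -> f t *m v = flow P X t *m v.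
Proof.
move=> hP hX X_itv cf sf sv Pv t01; have /andP[X0 Xpi] := X_itv.
have [->|v0] := eqVneq v 0; first by rewrite !mulmx0.
have nv := vnorm_gt0 v0; set u := ((vnorm v)^-1)%:C%C *: v.
have su : SX X u by rewrite /SX /= -scalemxAr sv scaler0.
have Pu : P *m u = u by rewrite /u -scalemxAr Pv.
have u1 : rdot u u = 1 by rewrite rdotZl rdotZr -vnorm_sqr; field; rewrite gt_eqF.
have vu : v = (vnorm v)%:C%C *: u.
  by rewrite scalerA -rmorphM mulfV ?gt_eqF // scale1r.
clearbody u.
have c2 := flow_cos_2angle hP hX X0 su Pu u1.
have cflow := flow_curve hP hX.
have sflow s : 0 < s < 1 -> mxderivable (flow P X) s ->
  opnorm (mxderive (flow P X) s) = opnorm X by move=> _ _; exact: flow_speed.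
rewrite vu -!scalemxAr.
rewrite (_ : f t *m u = flow P X t *m u); first reflexivity.
apply: vec_eqP => q.
have c2' : cos_2angle (flow P X 1) u <= cos (2 * opnorm X) by rewrite c2.
have E1 := rigidity cf sf u1 Pu X_itv c2' t01 q.
exact: etrans E1 (esym (rigidity cflow sflow u1 Pu X_itv c2' t01 q)).
Qed.

Lemma geodesic_unique (R : realType) (n : nat) (P X : 'M[R[i]]_n) f v t :
  orthproj P -> tangent P X -> 0 < opnorm X < pi / 2 ->
  grass_curve P (flow P X 1) f ->
  (forall t, 0 < t < 1 -> mxderivable f t -> opnorm (mxderive f t) = opnorm X) ->
  SX X v -> 0 <= t <= 1 -> f t *m v = flow P X t *m v.
Proof.
move=> hP hX X_itv cf sf sv t01; have /andP[X0 Xpi] := X_itv.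
have [h1 _] := hX; have [_ P2] := hP.
have sPv := SX_P hX X0 sv.
have e1 : f t *m (P *m v) = flow P X t *m (P *m v).
  by apply: geodesic_unique_range => //; rewrite mulmxA P2.
have hP' := orthproj_compl hP; have hX' := tangent_compl hX.
have sPv' := SX_P hX' X0 sv.
have cf' := curve_compl cf; rewrite -(flow_compl h1) in cf'.
have := geodesic_unique_range hP' hX' X_itv cf' (speed_compl sf) sPv' _ t01.
rewrite mulmxA hP'.2 => /(_ erefl).
rewrite (flow_compl h1) !(mulmxBl 1%:M) !mul1mx => /(congr1 (fun w => v - P *m
  v - w)).
rewrite !subKr !mulmxBr e1 => /eqP; rewrite (inj_eq (addIr _)) => /eqP.
exact.
Qed.

(** * Operators that are block diagonal with respect to a subspace and its orthogonal complement *)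

Lemma block_diagE (R : realType) (n k m : nat) (V : 'M[R[i]]_(n, k))
    (W : 'M[R[i]]_(n, m)) A B :
  block_diag V W A B = V *m A *m V^t* + W *m B *m W^t*.
Proof.
rewrite /block_diag mul_row_block !mulmx0 addr0 add0r.
by rewrite tr_row_mx map_col_mx mul_row_col.
Qed.

Section Blocks.
Context (R : realType) (n k m : nat) (S : set 'cV[R[i]]_n).
Context (V : 'M[R[i]]_(n, k)) (W : 'M[R[i]]_(n, m)).
Hypotheses (hV : onbasis S V) (hW : onbasis (orthoset S) W).

Lemma onbasis_orth : V^t* *m W = 0.
Proof.
apply: mx_eqP => c; rewrite mul0mx; apply: vec_eqP => d.
rewrite rdot0r -mulmxA rdot_adj trmxCK.
have [_ SV] := hV; have [_ SW] := hW.
have : orthoset S (W *m c) by rewrite SW; exists c.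
move=> /(_ (V *m d)); rewrite SV => H; rewrite /rdot H ?mxE //.
Qed.

Lemma onbasis_orthC : W^t* *m V = 0.
Proof. by rewrite -[V]trmxCK -trmxCM onbasis_orth linear0 map_mx0. Qed.

Lemma onbasis_split : V *m V^t* + W *m W^t* = 1%:M.
Proof.
have [VV SV] := hV; have [WW SW] := hW.
apply: mx_eqP => v; rewrite mul1mx.
have : orthoset S (v - V *m (V^t* *m v)).
  rewrite /orthoset /= SV => _ [c _ <-].
  by rewrite trmxCM -mulmxA mulmxBr (mulmxA (V^t*) V) VV mul1mx subrr mulmx0.
rewrite SW => -[c _ hc].
have Wv : W^t* *m v = c.
  have := congr1 (mulmx (W^t*)) hc.
  by rewrite mulmxA WW mul1mx mulmxBr (mulmxA (W^t*) V) onbasis_orthC mul0mx subr0.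
by rewrite mulmxDl -!mulmxA Wv hc addrC subrK.
Qed.

Lemma onbasis_mem v : S v -> V *m (V^t* *m v) = v.
Proof.
have [VV ->] := hV; move=> [c _ <-].
by rewrite (mulmxA (V^t*) V) VV mul1mx.
Qed.

Lemma invariant_block A : (forall v, S v -> S (A *m v)) ->
  A *m V = V *m (V^t* *m A *m V).
Proof.
move=> AS; apply: mx_eqP => c.
have Vc : S (V *m c) by have [_ ->] := hV; exists c.
by rewrite -!mulmxA onbasis_mem //; exact: AS.
Qed.

(** The adjoint of [A *m V = V *m G] shows that the block [V^t* *m A *m W] is [G^t* *m V^t* *m W],
    which is 0: an invariant subspace of a Hermitian operator reduces it. *)
Lemma hermitian_block A G : A^t* = A -> A *m V = V *m G ->
  A = V *m G *m V^t* + W *m (W^t* *m A *m W) *m W^t*.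
Proof.
move=> A1 AV.
have VA : V^t* *m A *m W = 0.
  by rewrite -A1 -trmxCM AV trmxCM -mulmxA onbasis_orth mulmx0.
have eW : A *m (W *m W^t*) = W *m (W^t* *m A *m W) *m W^t*.
  have e : A *m W = W *m (W^t* *m A *m W).
    rewrite -[LHS]mul1mx -onbasis_split mulmxDl -!(mulmxA V) (mulmxA (V^t*)) VA
      mulmx0 add0r.
    by rewrite -!mulmxA.
  by rewrite mulmxA e.
rewrite -eW -AV -(mulmxA A V) -mulmxDr onbasis_split mulmx1; reflexivity.
Qed.

Lemma block_compress A G B : A = V *m G *m V^t* + W *m B *m W^t* ->
  W^t* *m A *m W = B.
Proof.
have [WW _] := hW; move=> ->.
rewrite mulmxDr mulmxDl !mulmxA onbasis_orthC !mul0mx add0r WW mul1mx.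
by rewrite -mulmxA WW mulmx1.
Qed.

Lemma compress_orthproj A G : orthproj A -> A *m V = V *m G ->
  orthproj (W^t* *m A *m W).
Proof.
move=> [A1 A2] AV; have eA := hermitian_block A1 AV; have [WW _] := hW.
have [B eB] : exists B, W^t* *m A *m W = B by eexists.
rewrite eB in eA *.
have AW : A *m W = W *m B.
  by rewrite eA mulmxDl -!mulmxA onbasis_orth !mulmx0 add0r WW mulmx1.
split; first by rewrite -eB !trmxCM trmxCK A1 mulmxA.
by rewrite -{1}eB -(mulmxA _ W B) -AW mulmxA -(mulmxA (W^t*)) A2.
Qed.

Lemma range_compress_orthproj A G : orthproj A -> A *m V = V *m G -> orthproj G.
Proof.
have [VV _] := hV; move=> [A1 A2] AV.
have eG : G = V^t* *m A *m V by rewrite -mulmxA AV mulmxA VV mul1mx.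
split; first by rewrite eG !trmxCM trmxCK A1 mulmxA.
by rewrite {1}eG -(mulmxA _ V G) -AV mulmxA -(mulmxA (V^t*)) A2.
Qed.

Lemma block_orthproj G B : orthproj G -> orthproj B ->
  orthproj (V *m G *m V^t* + W *m B *m W^t*).
Proof.
have [VV _] := hV; have [WW _] := hW.
move=> [G1 G2] [B1 B2]; split.
  by rewrite linearD /= map_mxD !trmxCM !trmxCK G1 B1 !mulmxA.
rewrite mulmxDr !mulmxDl.
rewrite (_ : W *m B *m W^t* *m (V *m G *m V^t*) = 0); last first.
  by rewrite -!mulmxA (mulmxA (W^t*) V) onbasis_orthC mul0mx !mulmx0.
rewrite (_ : V *m G *m V^t* *m (W *m B *m W^t*) = 0); last first.
  by rewrite -!mulmxA (mulmxA (V^t*) W) onbasis_orth mul0mx !mulmx0.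
rewrite addr0 add0r; congr (_ + _).
- by rewrite -!mulmxA (mulmxA (V^t*) V) VV mul1mx (mulmxA G G) G2.
- by rewrite -!mulmxA (mulmxA (W^t*) W) WW mul1mx (mulmxA B B) B2.
Qed.

Lemma block_vnorm (a : 'cV_k) (b : 'cV_m) :
  vnorm (V *m a + W *m b) ^+ 2 = vnorm a ^+ 2 + vnorm b ^+ 2.
Proof.
have [VV _] := hV; have [WW _] := hW.
rewrite !vnorm_sqr rdotDl !rdotDr (rdotC (W *m b)) !rdot_adj !mulmxA VV WW.
by rewrite onbasis_orthC !mul1mx mul0mx (rdotC 0) rdot0r; ring.
Qed.

Lemma block_split_vnorm v : vnorm v ^+ 2 = vnorm (V^t* *m v) ^+ 2 + vnorm (W^t*
  *m v) ^+ 2.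
Proof. by rewrite -block_vnorm !mulmxA -mulmxDl onbasis_split mul1mx. Qed.

End Blocks.

Lemma infimum_length (R : realType) (n : nat) (P X : 'M[R[i]]_n) :
  orthproj P -> tangent P X -> 0 < opnorm X < pi / 2 ->
  ereal_inf [set curve_length g | g in grass_curve P (flow P X 1)] =
    (opnorm X)%:E.
Proof.
move=> hP hX X_itv; have /andP[X0 Xpi] := X_itv.
have [v [sv Pv v1]] := SX_range_neq0 hP hX X0.
have c2 := flow_cos_2angle hP hX X0 sv Pv v1.
apply/eqP; rewrite eq_le; apply/andP; split.
  apply: ereal_inf_lbound; exists (flow P X); first exact: flow_curve.
  have [pf _ _ _] := flow_curve hP hX.
  have := constant_speed_arclength pf (fun s _ _ => flow_speed hP hX X0 s)
    (lexx 0) ler01 (lexx 1).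
  by rewrite subr0 mulr1.
apply: le_ereal_inf_tmp => _ [g hg <-].
apply: (curve_length_ge hg v1 Pv); first by rewrite ltW.
by rewrite c2.
Qed.

Lemma flow_SX (R : realType) (n : nat) (P X : 'M[R[i]]_n) t v :
  orthproj P -> tangent P X -> 0 < opnorm X -> SX X v -> SX X (flow P X t *m v).
Proof.
move=> hP hX X0; have [h1 _] := hX.
exact: (SX_P (flow_tangent hX t) X0).
Qed.

Lemma flow_velocity_SX (R : realType) (n : nat) (P X : 'M[R[i]]_n) t v :
  orthproj P -> tangent P X -> 0 < opnorm X -> SX X v ->
  SX X (mxderive (flow P X) t *m v).
Proof.
move=> hP hX X0 sv; have [h1 _] := hX; have [_ ->] := flow_smooth h1 P.
have sX w := @SX_X R n P X hX X0 w.
have h : SX X (X *m (flow P X t *m v) - flow P X t *m (X *m v)).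
  have h2 := sX _ (flow_SX t hP hX X0 sv); have h3 := flow_SX t hP hX X0 (sX _ sv).
  by rewrite /SX /= mulmxBr h2 h3 subrr.
rewrite -scalemxAl mulmxBl -(mulmxA X) -(mulmxA _ X v).
by rewrite /SX /= -scalemxAr h scaler0.
Qed.

(** Identities between curves hold on [0,1] only; this turns them into identities near an interior
    point, which can be differentiated. *)
Lemma near_unit_itv (R : realType) (t : R) (p : R -> Prop) : 0 < t < 1 ->
  (forall s, 0 <= s <= 1 -> p s) -> \forall s \near t, p s.
Proof.
move=> t01 h; near=> s.
have : s \in `]0, 1[ by near: s; apply: near_in_itvoo; rewrite in_itv.
by rewrite in_itv /= => /andP[s0 s1]; apply: h; rewrite !ltW.
Unshelve. all: by end_near. Qed.

(** * Minimal curves and block diagonal curves *)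

Section BlockCurves.
Context (R : realType) (n k m : nat) (P X : 'M[R[i]]_n).
Context (V : 'M[R[i]]_(n, k)) (W : 'M[R[i]]_(n, m)).
Context (delta : R -> 'M[R[i]]_n).
Hypotheses (hP : orthproj P) (hX : tangent P X) (X_itv : 0 < opnorm X < pi / 2).
Hypotheses (hV : onbasis (SX X) V) (hW : onbasis (orthoset (SX X)) W).

Let X0 : 0 < opnorm X. Proof. by have /andP[] := X_itv. Qed.
Local Notation F := (flow P X).
Local Notation G t := (V^t* *m flow P X t *m V).

Lemma gammaXE t : gammaX V P X t = G t.
Proof.
have [VV _] := hV; rewrite /gammaX /restrict_to /projspan.
move: (flow P X t) => A.
by rewrite !mulmxA VV mul1mx -!mulmxA VV mulmx1.
Qed.

Lemma flow_V t : F t *m V = V *m G t.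
Proof. by apply: (invariant_block hV) => v; exact: flow_SX. Qed.

Lemma gamma_smooth : smooth_mx (fun t => G t).
Proof.
have [sF _] := flow_smooth hX.1 P.
by have := smooth_mx_congr (V^t*) sF; under eq_fun do rewrite trmxCK.
Qed.

Lemma gamma_derive t : mxderivable (fun t => G t) t /\
  mxderive (fun t => G t) t = V^t* *m mxderive F t *m V.
Proof.
have [sF _] := flow_smooth hX.1 P.
have := mxderive_congr (V^t*) (smooth_mxderivable t sF).
by under eq_fun do rewrite trmxCK; rewrite trmxCK.
Qed.

Lemma gamma_orthproj t : orthproj (G t).
Proof.
exact: (range_compress_orthproj hV (flow_orthproj hX.1 t hP) (flow_V t)).
Qed.

Lemma block_flow t : F t = V *m G t *m V^t* + W *m (W^t* *m F t *m W) *m W^t*.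
Proof.
have [F1 _] := flow_orthproj hX.1 t hP.
exact: (hermitian_block hV hW F1 (flow_V t)).
Qed.

Lemma minimal_block : grass_curve P (F 1) delta ->
  (forall t, 0 < t < 1 -> mxderivable delta t -> opnorm (mxderive delta t) =
    opnorm X) ->
  exists alpha : R -> 'M[R[i]]_m,
    [/\ grass_curve (restrict_to W P) (restrict_to W (F 1)) alpha,
        forall t, 0 < t < 1 -> mxderivable alpha t ->
          opnorm (mxderive alpha t) <= opnorm X &
        forall t, 0 <= t <= 1 ->
          delta t = block_diag V W (gammaX V P X t) (alpha t)].
Proof.
move=> cd sd; have [pd projd d0 d1] := cd; have [WW _] := hW.
have dV t : 0 <= t <= 1 -> delta t *m V = V *m G t.
  move=> t01; rewrite -flow_V; apply: mx_eqP => c.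
  rewrite -(mulmxA (delta t) V c) -(mulmxA (flow P X t) V c).
  apply: (geodesic_unique hP hX X_itv cd sd) => //.
  by have [_ ->] := hV; exists c.
pose al t := W^t* *m delta t *m W.
have eal t : 0 <= t <= 1 -> delta t = V *m G t *m V^t* + W *m al t *m W^t*.
  by move=> t01; have [D1 _] := projd t t01; exact: (hermitian_block hV hW D1
    (dV t t01)).
exists al; split.
- split.
  + apply: (piecewise_smooth_map (T := fun h s => W^t* *m h s *m W) _ _ pd).
      by move=> h sh; have := smooth_mx_congr (W^t*) sh; under eq_fun do
        rewrite trmxCK.
    by move=> h t _; rewrite /al => ->.
  + move=> t t01; exact: (compress_orthproj hV hW (projd t t01) (dV t t01)).
  + by rewrite /al d0.
  + by rewrite /al d1.
- move=> t t01 alt.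
  (* The speed of [delta] is known only where [delta] is derivable; this follows from derivability
     of [al], the other block being smooth. *)
  have ft : mxderivable delta t.
    have [h _] := mxderive_congr2 V W (gamma_derive t).1 alt.
    have e : \forall s \near t, V *m G s *m V^t* + W *m al s *m W^t* = delta s.
      by apply: near_unit_itv => // s s01; rewrite -eal.
    by have [] := near_mxderive e h.
  have [_ e] := mxderive_congr (W^t*) ft.
  have -> : mxderive al t = W^t* *m mxderive delta t *m W.
    have -> : al = fun s => W^t* *m delta s *m (W^t*)^t*.
      by apply/funext => s; rewrite trmxCK.
    by rewrite e trmxCK.
  apply: opnorm_le => [|v]; first exact: ltW.
  rewrite -(mulmxA _ W v) -(mulmxA (W^t*) (mxderive delta t)).
  have Wle w : vnorm (W^t* *m w) <= vnorm w.
    rewrite -(@ler_pXn2r _ 2) ?nnegrE ?vnorm_ge0 // (block_split_vnorm hV hW w).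
    by rewrite lerDr sqr_ge0.
  rewrite (le_trans (Wle _)) // (le_trans (vnorm_opnorm _ _)) // (sd t t01 ft).
  by rewrite (vnorm_unitary _ WW).
- by move=> t t01; rewrite block_diagE gammaXE; exact: eal.
Qed.

Lemma block_speed (al : R -> 'M[R[i]]_m) t :
  (forall t, 0 < t < 1 -> mxderivable al t -> opnorm (mxderive al t) <= opnorm X) ->
  (forall t, 0 <= t <= 1 -> delta t = V *m G t *m V^t* + W *m al t *m W^t*) ->
  0 < t < 1 -> mxderivable delta t -> opnorm (mxderive delta t) = opnorm X.
Proof.
move=> sal ed t01 dt; have [VV SV] := hV.
(* The bound on [al] is available only where [al] is derivable; being a compression of [delta], it
   is derivable wherever [delta] is. *)
have [a_der _] := mxderive_congr (W^t*) dt.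
have e : \forall s \near t, W^t* *m delta s *m (W^t*)^t* = al s.
  apply: near_unit_itv => // s s01; rewrite trmxCK.
  exact: (block_compress hV hW (ed s s01)).
have [alt _] := near_mxderive e a_der.
have [g_der eg] := gamma_derive t.
have [b_der eb] := mxderive_congr2 V W g_der alt.
have e' : \forall s \near t, V *m G s *m V^t* + W *m al s *m W^t* = delta s.
  by apply: near_unit_itv => // s s01; rewrite ed.
have [_ ->] := near_mxderive e' b_der; rewrite eb eg.
have sat := sal t t01 alt.
move: (mxderive al t) sat => A sat.
have Vle w : vnorm (V^t* *m w) <= vnorm w.
  rewrite -(@ler_pXn2r _ 2) ?nnegrE ?vnorm_ge0 // (block_split_vnorm hV hW w).
  by rewrite lerDl sqr_ge0.
have act w : (V *m (V^t* *m mxderive F t *m V) *m V^t* + W *m A *m W^t*) *m w =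
   V *m (V^t* *m (mxderive F t *m (V *m (V^t* *m w)))) + W *m (A *m (W^t* *m w)).
  by rewrite mulmxDl -!mulmxA.
(* On a vector of [SX X] the velocity is that of the flow and has norm [opnorm X * vnorm v]: the
   first block already attains the bound, which the second block does not exceed. *)
have [v [sv v0]] := SX_neq0 hX X0.
apply: (opnorm_eq (v := v)).
- exact: ltW.
- move=> w; rewrite act -(@ler_pXn2r _ 2) ?nnegrE ?mulr_ge0 ?vnorm_ge0 ?(ltW X0) //.
  rewrite (block_vnorm hV hW) exprMn (block_split_vnorm hV hW w) mulrDr -!exprMn.
  have Fle : vnorm (V^t* *m (mxderive F t *m (V *m (V^t* *m w)))) <=
      opnorm X * vnorm (V^t* *m w).
    rewrite (le_trans (Vle _)) // (flow_velocity hP hX).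
    by rewrite (le_trans (vnorm_opnorm _ _)) // (vnorm_unitary _ VV).
  have Ale : vnorm (A *m (W^t* *m w)) <= opnorm X * vnorm (W^t* *m w).
    by rewrite (le_trans (vnorm_opnorm _ _)) // ler_wpM2r ?vnorm_ge0.
  by apply: lerD; rewrite ler_pXn2r ?nnegrE ?mulr_ge0 ?vnorm_ge0 ?(ltW X0).
- exact: v0.
- have Wv : W^t* *m v = 0.
    by rewrite -(onbasis_mem hV sv) mulmxA (onbasis_orthC hV hW) mul0mx.
  rewrite act Wv !mulmx0 addr0 (onbasis_mem hV sv).
  rewrite (onbasis_mem hV (flow_velocity_SX t hP hX X0 sv)).
  by rewrite (flow_velocity hP hX) (SX_vnorm hX X0 sv).
Qed.

Lemma block_curve (al : R -> 'M[R[i]]_m) :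
  grass_curve (W^t* *m P *m W) (W^t* *m F 1 *m W) al ->
  (forall t, 0 <= t <= 1 -> delta t = V *m G t *m V^t* + W *m al t *m W^t*) ->
  grass_curve P (F 1) delta.
Proof.
move=> [pal projal al0 al1] ed; split.
- apply: (piecewise_smooth_map
    (T := fun h s => V *m G s *m V^t* + W *m h s *m W^t*) _ _ pal).
    by move=> h sh; exact: smooth_mx_congr2 gamma_smooth sh.
  by move=> h t t01 alh; rewrite (ed t t01) alh; reflexivity.
- move=> t t01; rewrite ed //; apply: (block_orthproj hV hW); last exact: projal.
  exact: gamma_orthproj.
- have z01 : 0 <= (0 : R) <= 1 by rewrite lexx ler01.
  have := block_flow 0; rewrite (flow0 hX.1 P) => e0.
  by rewrite (ed 0 z01) al0 (flow0 hX.1 P); exact: esym e0.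
- have z01 : 0 <= (1 : R) <= 1 by rewrite lexx ler01.
  by rewrite (ed 1 z01) al1; exact: esym (block_flow 1).
Qed.

End BlockCurves.

Theorem theorem3p3 (R : realType) (n : nat) (P Q X : 'M[R[i]]_n)
    (hP : orthproj P) (hQ : orthproj Q) (hPQ : opnorm (P - Q) < 1)
    (hX : tangent P X) (hXpi : opnorm X < pi / 2) (hQX : Q = flow P X 1)
    (hsigma : exists a b : R[i],
       [/\ a != b, eigenvalue (absmx X) a & eigenvalue (absmx X) b])
    (k m : nat) (V : 'M[R[i]]_(n, k)) (W : 'M[R[i]]_(n, m))
    (hV : onbasis (SX X) V) (hW : onbasis (orthoset (SX X)) W)
    (delta : R -> 'M[R[i]]_n) :
  minimal_curve P Q delta <->
  exists alpha1 : R -> 'M[R[i]]_m,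
    [/\ grass_curve (restrict_to W P) (restrict_to W Q) alpha1,
        forall t, 0 < t < 1 -> mxderivable alpha1 t ->
          opnorm (mxderive alpha1 t) <= opnorm X &
        forall t, 0 <= t <= 1 ->
          delta t = block_diag V W (gammaX V P X t) (alpha1 t)].
Proof.
have X_itv : 0 < opnorm X < pi / 2 by rewrite hXpi (opnorm_gt0_eigenvalues hsigma).
have inf := infimum_length hP hX X_itv; subst Q.
have length_speed c : grass_curve P (flow P X 1) delta ->
    (forall t, 0 < t < 1 -> mxderivable delta t -> opnorm (mxderive delta t) = c) ->
    curve_length delta = c%:E.
  move=> [pd _ _ _] sd.
  have := constant_speed_arclength pd sd (lexx 0) ler01 (lexx 1).
  by rewrite subr0 mulr1.
split=> [[cd ld [c sd]]|[al [cal sal ed]]].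
  apply: (minimal_block hP hX X_itv hV hW cd).
  (* On [0,1] the length of a curve of constant speed [c] is [c], so minimality identifies [c] with
     the infimum of the lengths. *)
  have : c%:E = (opnorm X)%:E by rewrite -(length_speed c cd sd) ld inf.
  by case=> <-.
have {}ed t : 0 <= t <= 1 ->
    delta t = V *m (V^t* *m flow P X t *m V) *m V^t* + W *m al t *m W^t*.
  by move=> t01; rewrite (ed t t01) block_diagE (gammaXE P hV).
have cd := block_curve hP hX X_itv hV hW cal ed.
have sd t := @block_speed R n k m P X V W delta hP hX X_itv hV hW al t sal ed.
split; first exact: cd.
- by rewrite inf; exact: length_speed.
- by exists (opnorm X).
Qed.
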